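(* Let $G$ be a finite simple graph on the vertex set $V(G)=\{x_{11},\ldots,x_{n1}\}$ with no isolated vertex. Let $0\leq m\leq n$. Let $C_1,\ldots,C_m$ be cycle graphs, with $C_i$ having vertex set $\{x_{i1},\ldots,x_{ik_i}\}$, and let $G_{m+1},\ldots,G_n$ be connected chordal graphs with at least two vertices, $G_i$ having vertex set $\{x_{i1},\ldots,x_{ik_i}\}$, such that for each $i=m+1,\ldots,n$ the vertex $x_{i1}$ is a neighbor of some simplicial vertex of $G_i$; all the sets $\{x_{i2},\ldots,x_{ik_i}\}$ are pairwise disjoint and disjoint from $V(G)$. Let $G'=G(C_1,\ldots,C_m,G_{m+1},\ldots,G_n)$ be the graph obtained by attaching $C_i$ (resp. $G_i$) to $G$ at $x_{i1}$ for each $i$. Then the following are equivalent: (1) $G'$ is unmixed; (2) $G'$ is Cohen--Macaulay; (3) $G'$ is unmixed and shellable; (4) $G'$ is unmixed and vertex decomposable; (5) each $C_i$ ($i=1,\ldots,m$) is a cycle of length $3$ or $5$, and $G_i$ is unmixed for every $i=m+1,\ldots,n$.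
   Context: Attaching means forming the graph whose vertex set is the union of the vertex sets and whose edge set is the union of $E(G)$ with the edge sets of the attached graphs. A graph is chordal if every cycle of length at least four has a chord; a vertex is simplicial if its neighbors form a clique. A graph is unmixed if all maximal independent sets have the same cardinality. A graph is Cohen--Macaulay if its edge ring $\mathbb{K}[x_v: v\in V]/(x_ux_v:\{u,v\}\in E)$ over a field $\mathbb{K}$ is Cohen--Macaulay; shellable if its independence complex is shellable; vertex decomposable if it has no edges, or else has a vertex $x$ with (a) $H\setminus N_H[x]$ and $H\setminus\{x\}$ vertex decomposable and (b) for every independent set $S$ of $H\setminus N_H[x]$ there is $y\in N_H(x)$ with $S\cup\{y\}$ independent in $H\setminus\{x\}$. *)

(* Defs.v *)
From HB Require Import structures.
From mathcomp Require Import all_boot all_order all_algebra.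
From mathcomp Require Import mpoly.
Set Implicit Arguments. Unset Strict Implicit. Unset Printing Implicit Defensive.
Import Order.TTheory GRing.Theory.
Local Open Scope ring_scope.

Record graph (T : finType) := Graph { verts : {set T}; adj : rel T }.

Section Graphs.
Variable T : finType.
Implicit Types (H : graph T) (S A : {set T}) (x y : T).

Definition simple_graph H : Prop :=
  [/\ forall x y, adj H x y = adj H y x,
      forall x, ~~ adj H x x &
      forall x y, adj H x y -> x \in verts H /\ y \in verts H].

Definition no_isolated_vertex H : Prop :=
  forall x, x \in verts H -> exists y, adj H x y.

Definition gdel H A : graph T :=
  Graph (verts H :\: A) (fun x y => [&& adj H x y, x \notin A & y \notin A]).

Definition nbhd H x : {set T} := [set y | adj H x y].
Definition cnbhd H x : {set T} := x |: nbhd H x.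

Definition independent H S : bool :=
  (S \subset verts H) && [forall x in S, forall y in S, ~~ adj H x y].

Definition unmixed H : Prop :=
  forall S1 S2, maxset (independent H) S1 -> maxset (independent H) S2 ->
    #|S1| = #|S2|.

Definition is_cycle_graph H : Prop :=
  exists k (f : 'I_k -> T),
    [/\ (3 <= k)%N, injective f, verts H = [set f i | i : 'I_k] &
        forall i j : 'I_k,
          adj H (f i) (f j) = ((i.+1 %% k == j)%N || (j.+1 %% k == i)%N)].

Definition connected_graph H : Prop :=
  forall x y, x \in verts H -> y \in verts H -> connect (adj H) x y.

Definition chordal H : Prop :=
  forall (x : T) (p : seq T), let s := x :: p in
    uniq s -> (4 <= size s)%N -> {subset s <= verts H} ->
    cycle (adj H) s ->
    exists i j, [/\ (i < j < size s)%N, j != i.+1,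
                    ~~ ((i == 0%N) && (j == (size s).-1)) &
                    adj H (nth x s i) (nth x s j)].

Definition simplicial H x : Prop :=
  x \in verts H /\
  forall a b, adj H x a -> adj H x b -> a != b -> adj H a b.

(* shellability of the independence complex (Bjorner--Wachs, non-pure):
   the facets (maximal independent sets) admit a linear order F_1,...,F_t
   such that for i < j there are v in F_j \ F_i and l < j with
   F_j \ F_l = {v}. *)
Definition shellable H : Prop :=
  exists s : seq {set T},
    [/\ uniq s,
        forall F, (F \in s) = maxset (independent H) F &
        forall i j, (i < j < size s)%N ->
          exists v, v \in nth set0 s j :\: nth set0 s i /\
            exists2 l, (l < j)%N & nth set0 s j :\: nth set0 s l = [set v]].

Inductive vertex_decomposable : graph T -> Prop :=
| vd_edgeless H : (forall x y, ~~ adj H x y) -> vertex_decomposable H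
| vd_shedding H x : x \in verts H ->
    vertex_decomposable (gdel H (cnbhd H x)) ->
    vertex_decomposable (gdel H [set x]) ->
    (forall S, independent (gdel H (cnbhd H x)) S ->
       exists2 y, adj H x y & independent (gdel H [set x]) (y |: S)) ->
    vertex_decomposable H.

Definition attach n H (Hs : 'I_n -> graph T) : graph T :=
  Graph (verts H :|: \bigcup_(i < n) verts (Hs i))
        (fun x y => adj H x y || [exists i, adj (Hs i) x y]).

End Graphs.

Section CM.
Variables (K : fieldType) (k : nat).
Local Notation P := {mpoly K[k]}.

Definition gen_ideal (gs : seq P) (p : P) : Prop :=
  exists cs : seq P, p = \sum_(i < size gs) cs`_i * gs`_i.

Definition prime_ideal (Q : P -> Prop) : Prop :=
  [/\ Q 0, forall a b, Q a -> Q b -> Q (a + b),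
      forall a b, Q b -> Q (a * b), ~ Q 1 &
      forall a b, Q (a * b) -> Q a \/ Q b].

(* a chain Q_0 < Q_1 < ... < Q_d of primes of K[x] containing (gs),
   i.e. a chain of primes of length d in K[x]/(gs) *)
Definition prime_chain (gs : seq P) (d : nat) : Prop :=
  exists Qs : nat -> P -> Prop,
    (forall i, (i <= d)%N -> prime_ideal (Qs i) /\
        forall p, gen_ideal gs p -> Qs i p) /\
    (forall i, (i < d)%N -> (forall p, Qs i p -> Qs i.+1 p) /\
        exists p, Qs i.+1 p /\ ~ Qs i p).

Definition krull_dim_eq (gs : seq P) (d : nat) : Prop :=
  prime_chain gs d /\ ~ prime_chain gs d.+1.

Definition max_gens : seq P := [seq 'X_i | i <- enum 'I_k].

Definition regular_seq (gs fs : seq P) : Prop :=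
  (forall i, (i < size fs)%N ->
     gen_ideal max_gens fs`_i /\
     forall g, gen_ideal (gs ++ take i fs) (fs`_i * g) ->
               gen_ideal (gs ++ take i fs) g) /\
  ~ gen_ideal (gs ++ fs) 1.

(* depth of R = K[x]/(gs) (grade of m on R) equals d *)
Definition depth_eq (gs : seq P) (d : nat) : Prop :=
  (exists fs, size fs = d /\ regular_seq gs fs) /\
  ~ (exists fs, size fs = d.+1 /\ regular_seq gs fs).

Definition cohen_macaulay_quotient (gs : seq P) : Prop :=
  exists d, depth_eq gs d /\ krull_dim_eq gs d.

End CM.

Definition edge_gens (K : fieldType) (T : finType) (H : graph T)
  : seq {mpoly K[#|verts H|]} :=
  [seq 'X_i * 'X_j | i <- enum 'I_#|verts H|,
     j <- [seq j <- enum 'I_#|verts H| | adj H (enum_val i) (enum_val j)]].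

Definition cohen_macaulay (K : fieldType) (T : finType) (H : graph T) : Prop :=
  cohen_macaulay_quotient (edge_gens K H).

(* Main.v *)
(* The attached pieces share one property: the root r i is a shedding vertex of
   its piece (the neighbouring simplicial vertex witnesses this for chordal
   pieces; in a 3- or 5-cycle one of the two neighbours of the root does), and
   removing the root leaves a graph all of whose induced subgraphs with an edge
   have a nonisolated simplicial vertex.  Hence in G' one may shed the roots
   first, in any order, and then neighbours of simplicial vertices, so G' is
   vertex decomposable and therefore shellable.  Shedding also makes maximal
   independent sets of G' restrict to maximal independent sets of the pieces,
   which gives unmixedness; the converse is an exchange argument.

   For Cohen-Macaulayness, depth <= dim P/p for every minimal prime p of the
   edge ideal forces unmixedness.  Conversely, a pure shelling filters the
   edge ring by polynomial rings k[F] shifted by monomials, and a sequence that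
   is regular on both ends of a short exact sequence is regular in the middle;
   the elementary symmetric polynomials e_d, ..., e_1 in all the variables
   restrict to a regular sequence on every k[F] with #|F| = d, over any field.
   Both upper bounds (dim <= d and depth <= d) come from the fact that more
   than d polynomials in d variables are algebraically dependent. *)
Require Import Defs.
From HB Require Import structures.
From mathcomp Require Import all_boot all_order all_algebra.
From mathcomp Require Import mpoly.
From mathcomp Require Import ring zify.
From Stdlib Require Import Classical FunctionalExtensionality.
Set Implicit Arguments. Unset Strict Implicit. Unset Printing Implicit Defensive.
Import Order.TTheory GRing.Theory.

(** * Regular sequences *)

Section WeaklyRegular.
Local Open Scope ring_scope.
Variable A : comNzRingType.
Implicit Types (J B C : A -> Prop) (f g : A) (fs : seq A).

Definition ideal J :=
  [/\ J 0, forall a b, J a -> J b -> J (a + b) & forall a b, J b -> J (a * b)].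

Lemma idealB J a b : ideal J -> J a -> J b -> J (a - b).
Proof. by case=> _ HD HM Ja Jb; apply: HD => //; rewrite -mulN1r; apply: HM. Qed.

Lemma ideal_subr J a b : ideal J -> J (a - b) -> J a <-> J b.
Proof.
move=> iJ Jab; split=> [Ja|Jb].
  have -> : b = a - (a - b) by ring.
  exact: idealB iJ Ja Jab.
by case: iJ => _ HD _; rewrite -[a](subrK b); apply: HD.
Qed.

Lemma ideal_sum J (I : Type) (r : seq I) (P : pred I) (F : I -> A) :
  ideal J -> (forall i, P i -> J (F i)) -> J (\sum_(i <- r | P i) F i).
Proof. by case=> J0 HD _ JF; elim/big_ind: _. Qed.

(** The ideal J + (f), formed without a list of generators so that quotients can be taken one
    element at a time. *)
Definition adjoin J f : A -> Prop := fun p => exists c, J (p - c * f).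

Lemma adjoin_ideal J f : ideal J -> ideal (adjoin J f).
Proof.
move=> iJ; have [J0 HD HM] := iJ; split.
- by exists 0; rewrite mul0r subr0.
- move=> a b [c Jc] [d Jd]; exists (c + d).
  have -> : a + b - (c + d) * f = a - c * f + (b - d * f) by ring.
  by apply: HD.
- move=> a b [c Jc]; exists (a * c).
  by rewrite -mulrA -mulrBr; apply: HM.
Qed.

Lemma sub_adjoin J f p : J p -> adjoin J f p.
Proof. by move=> Jp; exists 0; rewrite mul0r subr0. Qed.

Lemma mem_adjoin J f c : ideal J -> adjoin J f (c * f).
Proof. by case=> J0 _ _; exists c; rewrite subrr. Qed.

Lemma eq_adjoin J J' f : (forall p, J p <-> J' p) ->
  forall p, adjoin J f p <-> adjoin J' f p.
Proof. by move=> E p; split=> -[c Hc]; exists c; apply/E. Qed.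

(** Unlike for a regular sequence, the final quotient may be zero. The unit ideal is thereby
    allowed, and inductions on shellings and on products start there. *)
Fixpoint weakly_regular J fs : Prop :=
  if fs is f :: fs' then
    (forall g, J (f * g) -> J g) /\ weakly_regular (adjoin J f) fs'
  else True.

Lemma eq_weakly_regular J J' fs : (forall p, J p <-> J' p) ->
  weakly_regular J fs -> weakly_regular J' fs.
Proof.
elim: fs J J' => //= f fs IH J J' E [H1 H2]; split.
  by move=> g /E /H1 /E.
by apply: IH H2; apply: eq_adjoin.
Qed.

Lemma weakly_regular_nth J fs :
  weakly_regular J fs <->
  forall i, (i < size fs)%N -> forall g,
    foldl adjoin J (take i fs) (fs`_i * g) -> foldl adjoin J (take i fs) g.
Proof.
elim: fs J => [|f fs IH] J /=; first by split.
split=> [[H1 H2] [|i] //= Hi|H]; first exact: (IH _).1 H2 i Hi.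
split; first exact: (H 0%N).
by apply/IH => i Hi; apply: (H i.+1).
Qed.

(* [B], [C] and [J] are the annihilators of the three terms of the exact
   sequence 0 -> A/J -> A/B -> A/C -> 0 whose first map is multiplication by
   [a]; killing one more element keeps the sequence exact as long as that
   element is regular on A/C. *)
Lemma weakly_regular_extension J B C a fs :
  ideal J -> ideal B -> ideal C ->
  (forall w, J w <-> B (a * w)) -> (forall w, C w <-> adjoin B a w) ->
  weakly_regular J fs -> weakly_regular C fs -> weakly_regular B fs.
Proof.
elim: fs J B C => //= x fs IH J B C iJ iB iC EJ EC [Jx Jfs] [Cx Cfs].
have [B0 BD BM] := iB.
have subBC w : B w -> C w by move=> Bw; apply/EC/sub_adjoin.
split=> [g Bxg|].
  have /EC [z Bz] : C g by apply/Cx/subBC.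
  suff Jz : J z.
    by apply/(ideal_subr iB Bz); rewrite mulrC; apply/EJ.
  apply/Jx/EJ.
  have -> : a * (x * z) = x * g - x * (g - z * a) by ring.
  by apply: (idealB iB) => //; apply: BM.
apply: (IH (adjoin J x) _ (adjoin C x)) => //; try exact: adjoin_ideal.
- move=> w; split=> [[c /EJ Bc]|[y By]].
    exists (a * c); suff -> : a * w - a * c * x = a * (w - c * x) by [].
    by ring.
  have Cy : C y.
    apply: Cx; apply/EC; exists w.
    have -> : x * y - w * a = - 1 * (a * w - y * x) by ring.
    exact: BM.
  move/EC: Cy => [z Bz]; exists z; apply/EJ.
  have -> : a * (w - z * x) = a * w - y * x + x * (y - z * a) by ring.
  by apply: BD => //; apply: BM.
- move=> w; split=> [[c /EC [d Bd]]|[c [d Bd]]].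
    exists d, c; suff -> : w - d * a - c * x = w - c * x - d * a by [].
    by ring.
  exists d; apply/EC; exists c.
  suff -> : w - d * x - c * a = w - c * a - d * x by [].
  by ring.
Qed.

(** As f is regular modulo J, multiplication by f gives an exact sequence 0 -> A/(J+(g)) ->
    A/(J+(fg)) -> A/(J+(f)) -> 0, and regularity of [fs] passes from both ends to the middle. *)
Lemma weakly_regular_mul J f g fs : ideal J ->
  weakly_regular J (f :: fs) -> weakly_regular J (g :: fs) ->
  weakly_regular J (f * g :: fs).
Proof.
move=> iJ /= [Hf Wf] [Hg Wg]; split=> [h|].
  by rewrite -mulrA => /Hf /Hg.
have [J0 JD JM] := iJ.
apply: (weakly_regular_extension (a := f)) Wg Wf; try exact: adjoin_ideal.
- move=> w; split=> -[c Jc]; exists c.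
    have -> : f * w - c * (f * g) = f * (w - c * g) by ring.
    exact: JM.
  apply: Hf; have -> : f * (w - c * g) = f * w - c * (f * g) by ring.
  exact: Jc.
- move=> w; split=> [[c Jc]|[c [d Jd]]].
    by exists c; apply: sub_adjoin.
  exists (c + d * g).
  have -> : w - (c + d * g) * f = w - c * f - d * (f * g) by ring.
  exact: Jd.
Qed.

Lemma weakly_regular_one J fs : ideal J -> weakly_regular J (1 :: fs).
Proof.
move=> iJ /=; split=> [g|]; first by rewrite mul1r.
(* Modulo the unit ideal the quotient is zero, so every sequence is weakly regular. *)
have T J' : (forall p, J' p) -> weakly_regular J' fs.
  elim: fs J' => //= f fs IH J' HJ; split=> //.
  by apply: IH => p; exists 0.
by apply: T => p; rewrite -[p]mulr1; apply: mem_adjoin.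
Qed.

Lemma weakly_regular_prod J (I : Type) (r : seq I) (P : pred I) F fs : ideal J ->
  (forall i, P i -> weakly_regular J (F i :: fs)) ->
  weakly_regular J ((\prod_(i <- r | P i) F i) :: fs).
Proof.
move=> iJ W; elim/big_ind: _ => //; first exact: weakly_regular_one.
by move=> x y; apply: weakly_regular_mul.
Qed.

Lemma weakly_regular_congr J f g fs : ideal J -> J (f - g) ->
  weakly_regular J (f :: fs) -> weakly_regular J (g :: fs).
Proof.
move=> iJ Jfg /= [Hf Wf].
have [J0 JD JM] := iJ.
have E h : J (f * h) <-> J (g * h).
  by apply: ideal_subr => //; rewrite -mulrBl mulrC; apply: JM.
split=> [h /E /Hf //|].
apply: eq_weakly_regular Wf => p.
split=> -[c Jc]; exists c; move: Jc; apply: (ideal_subr iJ _).1.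
  have -> : p - c * f - (p - c * g) = - c * (f - g) by ring.
  exact: JM.
have -> : p - c * g - (p - c * f) = c * (f - g) by ring.
exact: JM.
Qed.

(** A power is a product of equal factors, so the head can be replaced with the tail kept; the
    induction then runs modulo the new head. *)
Lemma weakly_regular_pow J fs N : ideal J ->
  weakly_regular J fs -> weakly_regular J [seq f ^+ N | f <- fs].
Proof.
elim: fs J => //= f fs IH J iJ W.
have : weakly_regular J (f ^+ N :: fs).
  by rewrite -[N]subn0 -prodr_const_nat; apply: weakly_regular_prod.
by move=> /= [H1 /IH H2]; split=> //; apply: H2; apply: adjoin_ideal.
Qed.

End WeaklyRegular.

(** * Ideals given by finite lists of generators *)

Section GeneratedIdeals.
Local Open Scope ring_scope.
Variables (K : fieldType) (k : nat).
Local Notation P := {mpoly K[k]}.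
Implicit Types (gs fs : seq P) (J : P -> Prop).

(** [gen_ideal] leaves the length of the cofactor list free; cofactors indexed by all naturals add
    and scale termwise without padding. *)
Lemma gen_idealP gs p :
  gen_ideal gs p <->
  exists c : nat -> P, p = \sum_(i < size gs) c i * gs`_i.
Proof.
split=> [[cs ->]|[c ->]]; first by exists (nth 0 cs).
exists (mkseq c (size gs)); apply: eq_bigr => i _.
by rewrite nth_mkseq.
Qed.

Lemma gen_ideal_ideal gs : ideal (gen_ideal gs).
Proof.
split.
- by apply/gen_idealP; exists (fun=> 0); rewrite big1 // => i _; rewrite mul0r.
- move=> a b /gen_idealP [c ->] /gen_idealP [d ->].
  apply/gen_idealP; exists (fun i => c i + d i).
  by rewrite -big_split; apply: eq_bigr => i _; rewrite mulrDl.
- move=> a b /gen_idealP [c ->]; apply/gen_idealP; exists (fun i => a * c i).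
  by rewrite mulr_sumr; apply: eq_bigr => i _; rewrite mulrA.
Qed.

Lemma mem_gen_ideal gs g : g \in gs -> gen_ideal gs g.
Proof.
move=> /(nthP 0) [i Hi <-]; apply/gen_idealP.
exists (fun j => (j == i)%:R).
rewrite (bigD1 (Ordinal Hi)) //= eqxx mul1r big1 ?addr0 // => j /negPf.
by rewrite -val_eqE /= => ->; rewrite mul0r.
Qed.

Lemma gen_ideal_sub gs J p : ideal J -> (forall g, g \in gs -> J g) ->
  gen_ideal gs p -> J p.
Proof.
move=> iJ Hg [cs ->]; apply: ideal_sum => // i _.
by case: iJ => _ _ HM; apply/HM/Hg/mem_nth.
Qed.

Lemma gen_ideal_rcons gs f p :
  gen_ideal (rcons gs f) p <-> adjoin (gen_ideal gs) f p.
Proof.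
have E (c : nat -> P) : \sum_(i < size (rcons gs f)) c i * (rcons gs f)`_i =
    \sum_(i < size gs) c i * gs`_i + c (size gs) * f.
  rewrite size_rcons big_ord_recr /= nth_rcons ltnn eqxx; congr (_ + _).
  by apply: eq_bigr => i _; rewrite nth_rcons ltn_ord.
split=> [/gen_idealP [c ->]|[d /gen_idealP [c Hc]]].
  by exists (c (size gs)); apply/gen_idealP; exists c; rewrite E addrK.
apply/gen_idealP; exists (fun i => if (i < size gs)%N then c i else d).
rewrite (E (fun i => if (i < size gs)%N then c i else d)) ltnn.
apply/eqP; rewrite -subr_eq Hc; apply/eqP/eq_bigr => i _.
by rewrite ltn_ord.
Qed.

Lemma eq_foldl_adjoin (J J' : P -> Prop) fs : (forall p, J p <-> J' p) ->
  forall p, foldl (@adjoin P) J fs p <-> foldl (@adjoin P) J' fs p.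
Proof. by elim: fs J J' => //= f fs IH J J' E; apply/IH/eq_adjoin. Qed.

Lemma gen_ideal_cat gs fs p :
  gen_ideal (gs ++ fs) p <-> foldl (@adjoin P) (gen_ideal gs) fs p.
Proof.
elim: fs gs => [|f fs IH] gs /=; first by rewrite cats0.
rewrite -cat_rcons IH; apply: eq_foldl_adjoin => q.
exact: gen_ideal_rcons.
Qed.

Lemma weakly_regularP gs fs :
  weakly_regular (gen_ideal gs) fs <->
  forall i, (i < size fs)%N -> forall g,
    gen_ideal (gs ++ take i fs) (fs`_i * g) -> gen_ideal (gs ++ take i fs) g.
Proof.
rewrite weakly_regular_nth.
by split=> H i Hi g; move: (H i Hi g); rewrite !gen_ideal_cat.
Qed.

End GeneratedIdeals.

(** * Independence of power products along a chain of ideals *)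

Section Independence.
Local Open Scope ring_scope.
Variables (K : fieldType) (k : nat).
Local Notation P := {mpoly K[k]}.
Implicit Types (fs : seq P) (J : nat -> P -> Prop) (D t : nat).

Fixpoint exponents D t : seq (seq nat) :=
  if t is t'.+1 then [seq e :: a | e <- iota 0 D, a <- exponents D t']
  else [:: [::]].

Lemma size_exponents D t : size (exponents D t) = (D ^ t)%N.
Proof. by elim: t => //= t IH; rewrite size_allpairs size_iota IH expnS. Qed.

Lemma exponents_uniq D t : uniq (exponents D t).
Proof.
elim: t => //= t IH; apply: allpairs_uniq => //; first exact: iota_uniq.
by move=> [a b] [c d] _ _ /= [-> ->].
Qed.

Fixpoint power_product fs (a : seq nat) : P :=
  match fs, a with f :: fs', e :: a' => f ^+ e * power_product fs' a' | _, _ => 1 end.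

(** Modulo J only the constant term S 0 survives, because f lies in J; hence S 0 = 0. What remains
    is f times a shorter sum, and f cancels modulo I. *)
Lemma polynomial_in_quotient_zero (I J : P -> Prop) f n (S : nat -> P) :
  ideal J -> (forall g, I g -> J g) -> J f -> (forall g, I (f * g) -> I g) ->
  (forall e, (e < n)%N -> J (S e) -> S e = 0) ->
  I (\sum_(e < n) f ^+ e * S e) -> forall e, (e < n)%N -> S e = 0.
Proof.
move=> iJ IJ Jf If; have [J0 JD JM] := iJ.
elim: n S => // n IH S HS; rewrite big_ord_recl expr0 mul1r.
set T := \sum_(i < n) _ => IT.
have ET : T = f * \sum_(e < n) f ^+ e * S e.+1.
  by rewrite mulr_sumr; apply: eq_bigr => i _; rewrite exprS mulrA.
have S0 : S 0%N = 0.
  apply: HS => //; rewrite -[S 0%N](addrK T); apply: idealB => //; first exact: IJ.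
  by rewrite ET mulrC; apply: JM.
have IH' : forall e, (e < n)%N -> S e.+1 = 0.
  apply: (IH (fun e => S e.+1)) => [e He|]; first exact: HS.
  by apply: If; rewrite -ET; move: IT; rewrite S0 add0r.
by case=> [|e] He //; apply: IH'.
Qed.

(* Both a regular sequence (with J i a quotient by its first i terms) and a
   strict chain of primes (with f_i chosen in the i-th step) are of this form. *)
Lemma power_products_independent fs J D (c : seq nat -> K) :
  (forall i, (i <= size fs)%N -> ideal (J i)) ->
  (forall i, (i < size fs)%N -> forall g, J i g -> J i.+1 g) ->
  (forall i, (i < size fs)%N -> J i.+1 fs`_i) ->
  (forall i, (i < size fs)%N -> forall g, J i (fs`_i * g) -> J i g) ->
  ~ J (size fs) 1 ->
  J 0%N (\sum_(a <- exponents D (size fs)) c a *: power_product fs a) ->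
  forall a, a \in exponents D (size fs) -> c a = 0.
Proof.
elim: fs J c => [|f fs IH] J c /= iJ sJ fJ rJ pJ.
  (* With no element left the relation is the constant [c [::]]; if it were nonzero, its inverse
     would put 1 in the proper ideal [J 0]. *)
  rewrite big_seq1 => H a; rewrite inE => /eqP ->.
  apply/eqP/negP => /negP c0; apply: pJ.
  have [_ _ HM] := iJ 0%N isT.
  have := HM (c [::])^-1%:MP _ H.
  by rewrite mul_mpolyC scalerA mulVf // scale1r.
pose S c' := \sum_(a <- exponents D (size fs)) c' a *: power_product fs a.
(* The shifted chain [J i.+1] serves the tail. Grouping the relation by the exponent of [f] then
   reduces it to coefficients of this form. *)
have IH' c' : J 1%N (S c') -> forall a, a \in exponents D (size fs) -> c' a = 0.
  apply: (IH (fun i => J i.+1)) => // i Hi.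
  - exact: iJ.
  - exact: sJ.
  - exact: (fJ i.+1).
  - exact: (rJ i.+1).
have i1 : ideal (J 1%N) by apply: iJ.
rewrite big_allpairs_dep /= => H0.
have S0 : forall e, (e < D)%N -> S (fun a => c (e :: a)) = 0.
  apply: (polynomial_in_quotient_zero i1 (sJ 0%N isT) (fJ 0%N isT) (rJ 0%N isT)).
    move=> e He HS; rewrite /S big_seq big1 // => a Ha.
    by rewrite (IH' _ HS) // scale0r.
  move: H0; rewrite -{1}[D]subn0 -/(index_iota 0 D) big_mkord.
  congr (J _ _); apply: eq_bigr => e _; rewrite mulr_sumr.
  by apply: eq_bigr => a _; rewrite -scalerAr.
move=> _ /allpairsP [[e a] /= [He Ha ->]].
apply: (IH' (fun a => c (e :: a))) => //.
by rewrite S0; [case: i1 | move: He; rewrite mem_iota].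
Qed.

(** There are more polynomials than monomials, so the matrix of coefficients has more rows than
    columns and a nonzero left kernel. *)
Lemma linear_dependence (I : finType) (F : I -> P) (ms : seq 'X_{1..k}) :
  (forall i, {subset msupp (F i) <= ms}) -> (size ms < #|I|)%N ->
  exists c : I -> K, \sum_i c i *: F i = 0 /\ exists i, c i != 0.
Proof.
move=> Hms Hsize.
pose M := \matrix_(i < #|I|, j < size ms) (F (enum_val i))@_(nth 0%MM ms j).
have : kermx M != 0.
  rewrite kermx_eq0; apply: contraTN Hsize => /eqP <-.
  by rewrite -leqNgt rank_leq_col.
case/rowV0Pn => v /sub_kermxP Hv /rV0Pn [i0 Hi0].
exists (fun i => v 0 (enum_rank i)); split; last first.
  by exists (enum_val i0); rewrite enum_valK.
apply/mpolyP => m; rewrite mcoeff0 raddf_sum /=.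
have [Hm|Hm] := boolP (m \in ms); last first.
  rewrite big1 // => i _; rewrite mcoeffZ memN_msupp_eq0 ?mulr0 //.
  by apply: contra Hm => /Hms.
move/matrixP: Hv => /(_ 0) Hv.
have Hj : (index m ms < size ms)%N by rewrite index_mem.
move: (Hv (Ordinal Hj)); rewrite !mxE => Ej; rewrite -[RHS]Ej.
rewrite [RHS](reindex (@enum_rank I)) /=; last first.
  by apply: onW_bij; exists enum_val; [exact: enum_rankK|exact: enum_valK].
by apply: eq_bigr => i _; rewrite !mxE enum_rankK nth_index // mcoeffZ.
Qed.

End Independence.

(** * Stanley-Reisner ideals *)

Section StanleyReisner.
Local Open Scope ring_scope.
Variables (K : fieldType) (k : nat).
Local Notation P := {mpoly K[k]}.
Implicit Types (F R S : {set 'I_k}) (fl : seq {set 'I_k}) (m : 'X_{1..k}).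
Implicit Types (p q : P) (gs fs : seq P).

Definition msupport m : {set 'I_k} := [set i | m i != 0%N].

(** The projection onto k[F], which is kept inside the full polynomial ring; all the quotients k[F]
    thus share one type. *)
Definition restrict F : P -> P :=
  comp_mpoly [tuple if i \in F then 'X_i else 0 | i < k].

HB.instance Definition _ F := GRing.RMorphism.copy (restrict F)
  (comp_mpoly [tuple if i \in F then ('X_i : P) else 0 | i < k]).

Lemma restrictB F p q : restrict F (p - q) = restrict F p - restrict F q.
Proof. exact: raddfB. Qed.

Lemma restrictM F p q : restrict F (p * q) = restrict F p * restrict F q.
Proof. exact: rmorphM. Qed.

Lemma restrict_sum F (I : Type) (r : seq I) (Q : pred I) (E : I -> P) :
  restrict F (\sum_(i <- r | Q i) E i) = \sum_(i <- r | Q i) restrict F (E i).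
Proof. exact: raddf_sum. Qed.

Lemma restrictZ F c p : restrict F (c *: p) = c *: restrict F p.
Proof. exact: comp_mpolyZ. Qed.

Lemma restrictX F m :
  restrict F 'X_[m] = if msupport m \subset F then 'X_[m] else 0.
Proof.
rewrite /restrict comp_mpolyX; case: ifPn => [/subsetP sF|/subsetPn [i]].
  rewrite [RHS]mpolyXE_id; apply: eq_bigr => i _; rewrite tnth_mktuple.
  case: ifPn => // iF; have : i \notin msupport m by apply: contra iF => /sF.
  by rewrite inE negbK => /eqP ->; rewrite !expr0.
rewrite inE => mi /negPf iF.
by rewrite (bigD1 i) //= tnth_mktuple iF expr0n (negPf mi) mul0r.
Qed.

Lemma mcoeff_restrict F p m :
  (restrict F p)@_m = if msupport m \subset F then p@_m else 0.
Proof.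
rewrite {1}[p]mpolyE (raddf_sum (restrict F)) (raddf_sum (mcoeff m)) /=.
have E m' : (restrict F (p@_m' *: 'X_[m']))@_m =
    (if msupport m \subset F then 1 else 0) * (p@_m' *: 'X_[m'])@_m.
  rewrite restrictZ restrictX !mcoeffZ.
  have [->|ne] := eqVneq m' m; first by case: ifP => _; rewrite ?mcoeff0; ring.
  rewrite mcoeffX (negPf ne) !mulr0; case: ifP => _; last by rewrite mcoeff0 mulr0.
  by rewrite mcoeffX (negPf ne) mulr0.
under eq_bigr do rewrite E.
rewrite -mulr_sumr -(raddf_sum (mcoeff m)) -mpolyE.
by case: ifP; rewrite (mul1r, mul0r).
Qed.

Lemma restrict_eq0 F p :
  restrict F p = 0 <-> forall m, msupport m \subset F -> p@_m = 0.
Proof.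
split=> [/mpolyP H m sF|H]; first by move: (H m); rewrite mcoeff_restrict sF mcoeff0.
by apply/mpolyP => m; rewrite mcoeff_restrict mcoeff0; case: ifP => // /H.
Qed.

Lemma restrict_restrict F S p :
  restrict F (restrict S p) = restrict (F :&: S) p.
Proof.
by apply/mpolyP => m; rewrite !mcoeff_restrict subsetI; case: (_ \subset F).
Qed.

(** The prime P_F generated by the variables outside F. As the kernel of an endomorphism of a domain
    it is visibly prime. *)
Definition subspace_ideal F : P -> Prop := fun p => restrict F p = 0.

Lemma subspace_ideal_prime F : prime_ideal (subspace_ideal F).
Proof.
rewrite /subspace_ideal; split.
- by rewrite raddf0.
- by move=> a b Ha Hb; rewrite raddfD /= Ha Hb addr0.
- by move=> a b Hb; rewrite rmorphM /= Hb mulr0.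
- by rewrite rmorph1 => /eqP; rewrite oner_eq0.
- move=> a b; rewrite rmorphM /= => /eqP; rewrite mulf_eq0.
  by case/orP => /eqP; [left|right].
Qed.

Lemma prime_ideal_ideal (Q : P -> Prop) : prime_ideal Q -> ideal Q.
Proof. by case. Qed.

Lemma subspace_ideal_ideal F : ideal (subspace_ideal F).
Proof. exact/prime_ideal_ideal/subspace_ideal_prime. Qed.

Lemma msize_restrict F p : (msize (restrict F p) <= msize p)%N.
Proof.
rewrite [X in (X <= _)%N]msizeE; apply/bigmax_leqP_seq => m Hm _.
apply: msize_mdeg_lt; move: Hm; rewrite !mcoeff_msupp mcoeff_restrict.
by case: ifP; rewrite ?eqxx.
Qed.

(** * A dimension bound by counting monomials *)

Lemma msize_power_product D d (fs : seq P) a :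
  (forall f, f \in fs -> msize f < d)%N -> a \in exponents D (size fs) ->
  (msize (power_product fs a) <= (size fs * (D * d)).+1)%N.
Proof.
elim: fs a => [|f fs IH] a Hfs /=; first by rewrite msize1.
case/allpairsP => -[e b] /= [He Hb ->].
rewrite mem_iota /= add0n in He.
have {}IH : (msize (power_product fs b) <= (size fs * (D * d)).+1)%N.
  by apply: IH => // g Hg; apply: Hfs; rewrite inE Hg orbT.
have Hf : (msize f < d)%N by apply: Hfs; rewrite inE eqxx.
have Hpow : (msize (f ^+ e * power_product fs b) <= e * d + msize (power_product fs b))%N.
  elim: {He} e => [|e IHe]; first by rewrite expr0 mul1r.
  rewrite exprS -mulrA; apply: leq_trans (msizeM_le _ _) _.
  by rewrite mulSn -addnA -addSn; apply: leq_add.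
apply: leq_trans Hpow _; rewrite mulSn -addnS; apply: leq_add => //.
by rewrite leq_mul2r ltnW ?orbT.
Qed.

(** With t = [size fs], there are D^t power products, but modulo P_F their degrees are linear in D,
    so they involve only O(D^#|F|) monomials. If t exceeded #|F|, a large D would force a linear
    relation, against [power_products_independent]. *)
Lemma chain_length_le_dim (fs : seq P) (J : nat -> P -> Prop) F :
  (forall i, (i <= size fs)%N -> ideal (J i)) ->
  (forall i, (i < size fs)%N -> forall g, J i g -> J i.+1 g) ->
  (forall i, (i < size fs)%N -> J i.+1 fs`_i) ->
  (forall i, (i < size fs)%N -> forall g, J i (fs`_i * g) -> J i g) ->
  ~ J (size fs) 1 ->
  (forall p, subspace_ideal F p -> J 0%N p) ->
  (size fs <= #|F|)%N.
Proof.
move=> iJ sJ fJ rJ pJ FJ; rewrite leqNgt; apply/negP => lt_F.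
pose t := size fs; pose d := (\max_(f <- fs) msize f).+1.
(* Chosen so that (N+1)^#|F| <= D^#|F| (td+1)^#|F| < D^(#|F|+1) <= D^t. *)
pose D := ((t * d).+1 ^ #|F|).+1.
pose box := exponents D t.
pose N := (t * (D * d))%N.
(* The monomials supported on F with exponents at most N; [pffun_on] forces the value 0 outside
   F. *)
pose ms := [seq [multinom (g i : nat) | i < k] |
             g : {ffun 'I_k -> 'I_N.+1} in pffun_on ord0 F predT].
have Hd f : f \in fs -> (msize f < d)%N by move=> Hf; apply: leq_bigmax_seq.
have Hms (i : 'I_(size box)) :
    {subset msupp (restrict F (power_product fs (nth [::] box i))) <= ms}.
  move=> m Hm.
  have mN j : (m j < N.+1)%N.
    have := msize_mdeg_lt Hm; rewrite mdegE (bigD1 j) //= => Hlt.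
    apply: leq_ltn_trans (leq_addr _ _) (leq_trans Hlt _).
    apply: leq_trans (msize_restrict _ _) _.
    by apply: msize_power_product => //; apply: mem_nth.
  apply/imageP; exists [ffun j => Ordinal (mN j)]; last first.
    by apply/mnmP => j; rewrite mnmE ffunE.
  apply/pffun_onP; split; last by [].
  apply/subsetP => j; rewrite inE ffunE -val_eqE /= => mj.
  move: Hm; rewrite mcoeff_msupp mcoeff_restrict.
  case: ifP => [/subsetP sF _|]; last by rewrite eqxx.
  by apply: sF; rewrite inE.
have Hsize : (size ms < #|'I_(size box)|)%N.
  rewrite size_image card_pffun_on !card_ord size_exponents.
  have le1 : (N.+1 <= D * (t * d).+1)%N.
    by rewrite /N mulnS mulnCA addnC -addn1 leq_add.
  have le2 : (N.+1 ^ #|F| <= (D * (t * d).+1) ^ #|F|)%N.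
    by have [->|F0] := posnP #|F|; rewrite ?expn0 ?leq_exp2r.
  apply: leq_ltn_trans le2 _.
  rewrite expnMn; apply: (@leq_trans (D ^ #|F|.+1)); last by rewrite leq_pexp2l.
  by rewrite expnSr ltn_mul2l expn_gt0 /=.
have [c [Hc [i0 Hi0]]] := linear_dependence Hms Hsize.
(* The coefficients, indexed by positions in [box], are moved to exponent lists; lists outside [box]
   get 0. *)
pose c' a := oapp c 0 (insub (index a box)).
have c'E (i : 'I_(size box)) : c' (nth [::] box i) = c i.
  by rewrite /c' index_uniq ?exponents_uniq // valK.
move/eqP: Hi0; apply; rewrite -c'E.
apply: (power_products_independent (D := D) iJ sJ fJ rJ pJ); last exact: mem_nth.
apply: FJ; rewrite /subspace_ideal restrict_sum -[RHS]Hc (big_nth [::]) big_mkord.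
by apply: eq_bigr => i _; rewrite restrictZ c'E.
Qed.

(** The intersection of the primes P_F over the listed faces. For the empty list it is the unit
    ideal. *)
Definition stanley_reisner fl : P -> Prop :=
  fun p => forall F, F \in fl -> restrict F p = 0.

Lemma stanley_reisner_ideal fl : ideal (stanley_reisner fl).
Proof.
split=> [F _|a b Ha Hb F HF|a b Hb F HF]; first by rewrite raddf0.
  by rewrite raddfD /= Ha // Hb // addr0.
by rewrite rmorphM /= Hb // mulr0.
Qed.

Lemma msupport_mesym1 R : msupport (mesym1 R) = R.
Proof. by apply/setP => i; rewrite inE mnmE; case: (i \in R). Qed.

Lemma restrict_mesym1 F R :
  restrict F 'X_[mesym1 R] = if R \subset F then 'X_[mesym1 R] else 0.
Proof. by rewrite (restrictX _ (mesym1 R)) msupport_mesym1. Qed.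

Lemma msupportU (i : 'I_k) : msupport U_(i) = [set i].
Proof. by rewrite -mesym1_set1 msupport_mesym1. Qed.

Lemma restrictU F (i : 'I_k) : restrict F 'X_i = if i \in F then 'X_i else 0.
Proof. by rewrite (restrictX _ U_(i)) msupportU sub1set. Qed.

Lemma mesym1X R : 'X_[mesym1 R] = \prod_(i in R) 'X_i :> P.
Proof.
rewrite mpolyXE_id [RHS]big_mkcond; apply: eq_bigr => i _.
by rewrite mnmE; case: ifP.
Qed.

(** A monomial supported on F and missing some v of R is supported on F minus v, where p has no
    terms. So every remaining monomial is divisible by x^R. *)
Lemma restrict_divisible F R p : (forall v, v \in R -> restrict (F :\ v) p = 0) ->
  exists z, restrict F p = z * 'X_[mesym1 R].
Proof.
move=> H; exists (\sum_(m <- msupp (restrict F p))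
  (restrict F p)@_m *: 'X_[m - mesym1 R]).
rewrite {1}[restrict F p]mpolyE mulr_suml big_seq [RHS]big_seq.
apply: eq_bigr => m Hm; rewrite -scalerAl -mpolyXD submK //.
apply/mnm_lepP => i; rewrite mnmE; case: (boolP (i \in R)) => //= iR.
rewrite lt0n; apply: contraTneq Hm => mi; rewrite mcoeff_msupp negbK.
rewrite mcoeff_restrict; case: ifP => // /subsetP sF.
apply/eqP; move/restrict_eq0: (H i iR); apply.
apply/subsetP => j jm; rewrite in_setD1 sF // andbT.
by apply: contraTneq jm => ->; rewrite inE mi.
Qed.

Lemma restrict_sub F R p : F \subset R -> restrict R p = 0 -> restrict F p = 0.
Proof. by move=> /setIidPl <- HR; rewrite -restrict_restrict HR raddf0. Qed.

Fixpoint elementary_symmetrics d : seq P :=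
  if d is d'.+1 then mesym k K d :: elementary_symmetrics d' else [::].

Lemma size_elementary_symmetrics d : size (elementary_symmetrics d) = d.
Proof. by elim: d => //= d ->. Qed.

(* Modulo the ideal of F, the top symmetric function is the product of the
   variables in F; killing one of them leaves the same problem for one
   variable less. *)
Lemma elementary_symmetrics_regular F d : #|F| = d ->
  weakly_regular (subspace_ideal F) (elementary_symmetrics d).
Proof.
elim: d F => [|d IH] F HF; first by [].
rewrite [elementary_symmetrics _]/=.
have iF := @subspace_ideal_ideal.
apply: (@weakly_regular_congr _ _ (\prod_(i in F) 'X_i)) => //.
  rewrite /subspace_ideal restrictB -mesym1X restrict_mesym1 subxx.
  rewrite mesymE restrict_sum (bigD1 F) ?HF //= restrict_mesym1 subxx.
  rewrite big1 ?addr0 ?subrr // => G /andP[/eqP HG neF].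
  rewrite restrict_mesym1; case: ifP => // sGF.
  by move: neF; rewrite eqEcard sGF HF HG leqnn.
apply: weakly_regular_prod => // v vF; split=> [g|].
  rewrite /subspace_ideal restrictM restrictU vF => /eqP.
  rewrite mulf_eq0 => /orP[/eqP HX|/eqP //].
  move/mpolyP/(_ U_(v)%MM): HX; rewrite mcoeffX mcoeff0 eqxx => /eqP.
  by rewrite oner_eq0.
(* P_F + (x_v) is the prime of F minus v, so the induction hypothesis applies to the tail. *)
apply: eq_weakly_regular (IH (F :\ v) _); last first.
  by move: HF; rewrite (cardsD1 v) vF => -[].
move=> p; split=> [Hp|[c Hc]].
  have [w|z Hz] := @restrict_divisible F [set v] p; first by rewrite inE => /eqP ->.
  exists z; rewrite /subspace_ideal -mesym1_set1 -Hz restrictB.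
  by rewrite restrict_restrict setIid subrr.
have := restrict_sub (subsetDl F [set v]) Hc.
rewrite restrictB restrictM restrictU setD11 mulr0 subr0.
by [].
Qed.

(* With R the restriction face of the j-th facet F, multiplication by x^R
   embeds k[F] into k[F_1, ..., F_j] with cokernel k[F_1, ..., F_(j-1)]. *)
Lemma shelling_regular (s : seq {set 'I_k}) (th : seq P) :
  (forall i j, (i < j < size s)%N ->
     exists v, v \in nth set0 s j :\: nth set0 s i /\
       exists2 l, (l < j)%N & nth set0 s j :\: nth set0 s l = [set v]) ->
  (forall F, F \in s -> weakly_regular (subspace_ideal F) th) ->
  weakly_regular (stanley_reisner s) th.
Proof.
move=> Hs Hth; rewrite -[s]take_size.
elim: {-2}(size s) (leqnn (size s)) => [_|j IH Hj].
  rewrite take0; have [_] := weakly_regular_one th (@stanley_reisner_ideal [::]).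
  by apply: eq_weakly_regular => p; split=> // _; exists 0 => F.
have {}IH := IH (ltnW Hj).
set F := nth set0 s j.
have Fs : F \in s by apply: mem_nth.
pose R := [set v in F | has (fun G : {set 'I_k} => F :\: G == [set v]) (take j s)].
have RP v : v \in R -> exists2 G, G \in take j s & F :\: G = [set v].
  by rewrite inE => /andP[_ /hasP [G HG /eqP E]]; exists G.
have sRF : R \subset F by apply/subsetP => v; rewrite inE => /andP[].
(* No earlier facet G contains R: the shelling condition yields v in F minus G which is the whole of
   F minus some earlier facet, hence v is in R. *)
have RG G : G \in take j s -> restrict G ('X_[mesym1 R] : P) = 0.
  move=> HG; rewrite restrict_mesym1; case: ifP => // /subsetP sRG.
  have [i Hi EG] := nthP set0 HG.
  have ij : (i < j)%N by move: Hi; rewrite size_take Hj.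
  have [|v [Hv [l lj El]]] := Hs i j; first by rewrite ij.
  move: Hv; rewrite -/F in El *; rewrite -EG nth_take // in sRG *.
  rewrite inE => /andP[/negP vG vF]; case: vG; apply: sRG.
  rewrite inE vF; apply/hasP; exists (nth set0 s l); last by rewrite El.
  by rewrite -(nth_take _ lj); apply: mem_nth; rewrite size_take Hj.
have RF : restrict F ('X_[mesym1 R] : P) = 'X_[mesym1 R].
  by rewrite restrict_mesym1 sRF.
have X0 : 'X_[mesym1 R] != 0 :> P.
  apply/eqP => /mpolyP /(_ (mesym1 R)); rewrite mcoeffX eqxx mcoeff0 => /eqP.
  by rewrite oner_eq0.
have Ej : take j.+1 s = rcons (take j s) F by rewrite -take_nth.
apply: (@weakly_regular_extension _ (subspace_ideal F) _
  (stanley_reisner (take j s)) 'X_[mesym1 R]) IH; rewrite ?Ej; last exact: Hth;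
  do ?[exact: stanley_reisner_ideal | exact: subspace_ideal_ideal].
- move=> w; split=> [Hw G|Hw].
    rewrite mem_rcons inE restrictM => /predU1P[->|HG]; first by rewrite Hw mulr0.
    by rewrite RG // mul0r.
  have := Hw F; rewrite mem_rcons inE eqxx restrictM RF => /(_ isT) /eqP.
  by rewrite mulf_eq0 (negPf X0) => /eqP.
- move=> w; split=> [Hw|[z Hz] G HG]; last first.
    have := Hz G; rewrite mem_rcons inE HG orbT restrictB restrictM RG // mulr0 subr0.
    exact.
  (* For v in R, the face F minus v lies in an earlier facet, where w vanishes; so the restriction
     of w to F is a multiple of x^R. *)
  have [v /RP [G HG E]|z Hz] := @restrict_divisible F R w.
    apply: (restrict_sub (R := G)) (Hw G HG).
    rewrite -E; apply/subsetP => x; rewrite !inE.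
    by case: (x \in G); case: (x \in F).
  exists z => G; rewrite -Hz restrictB restrict_restrict mem_rcons inE.
  case/predU1P => [->|HG]; first by rewrite setIid subrr.
  by rewrite setIC -restrict_restrict Hw // raddf0 subr0.
Qed.

(** * Bounds on depth and on chains of primes *)

Lemma max_gens_restrict0 p : gen_ideal (max_gens K k) p -> restrict set0 p = 0.
Proof.
apply: (gen_ideal_sub (J := subspace_ideal set0)); first exact: subspace_ideal_ideal.
move=> g /mapP [i _ ->]; rewrite /subspace_ideal restrictU.
by rewrite inE.
Qed.

Definition order_ge n p := forall m, (mdeg m < n)%N -> p@_m = 0.

Lemma order_geM a b p q : order_ge a p -> order_ge b q -> order_ge (a + b) (p * q).
Proof.
move=> Hp Hq m Hm; rewrite mcoeffM big1 // => -[m1 m2] /= /eqP E.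
have {E} Hm12 : (mdeg m1 + mdeg m2 < a + b)%N by rewrite -mdegD -E.
have [lt1|ge1] := ltnP (mdeg m1) a; first by rewrite Hp ?mul0r.
rewrite Hq ?mulr0 //; rewrite -(ltn_add2l a).
by apply: leq_ltn_trans Hm12; rewrite leq_add2r.
Qed.

Lemma order_ge_pow p n : restrict set0 p = 0 -> order_ge n (p ^+ n).
Proof.
move=> /restrict_eq0 Hp; elim: n => [|n IH] //; rewrite exprS.
apply: (@order_geM 1) => // m; rewrite ltnS leqn0 mdeg_eq0 => /eqP ->.
by apply: Hp; apply/subsetP => i; rewrite inE mnm0E.
Qed.

(* A monomial supported on F spans a copy of k[F] = P/P_F inside P/I.  If fs
   were longer than dim P/P_F, a polynomial relation modulo P_F between the
   N-th powers of fs would put that monomial in I + (f_1^N, f_2^N, ...),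
   which is impossible for degree reasons once N is large. *)
Lemma regular_seq_size_le gs fl F fs :
  (forall p, gen_ideal gs p <-> stanley_reisner fl p) ->
  F \in fl -> (forall G, G \in fl -> F \subset G -> G = F) ->
  regular_seq gs fs -> (size fs <= #|F|)%N.
Proof.
move=> Hgs Ffl Fmax [Hreg _].
(* The terms of these powers have degree above #|F|, the degree of the monomial u below, so none of
   them divides u. *)
pose fN := [seq f ^+ #|F|.+1 | f <- fs].
have regN : weakly_regular (gen_ideal gs) fN.
  apply/weakly_regular_pow; first exact: gen_ideal_ideal.
  by apply/weakly_regularP => i /Hreg [].
have -> : size fs = size fN by rewrite size_map.
pose u : P := 'X_[mesym1 F].
(* The colon ideals of u; regularity of [fN] is inherited by them. *)
pose J i p := gen_ideal (gs ++ take i fN) (p * u).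
have iJ i := gen_ideal_ideal (gs ++ take i fN).
apply: (@chain_length_le_dim fN J).
- move=> i _; have [J0 JD JM] := iJ i; split.
  + by rewrite /J mul0r.
  + by move=> a b Ja Jb; rewrite /J mulrDl; apply: JD.
  + by move=> a b Jb; rewrite /J -mulrA; apply: JM.
- move=> i Hi g; apply: gen_ideal_sub; first exact: iJ.
  move=> h; rewrite mem_cat => Hh; apply: mem_gen_ideal.
  rewrite mem_cat (take_nth 0) // mem_rcons inE.
  by case/orP: Hh => ->; rewrite ?orbT.
- move=> i Hi; have [_ _ JM] := iJ i.+1.
  rewrite /J mulrC; apply: JM; apply: mem_gen_ideal.
  by rewrite mem_cat (take_nth 0) // mem_rcons inE eqxx orbT.
- move=> i Hi g; rewrite /J -mulrA.
  by move/weakly_regularP: regN => /(_ i Hi); apply.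
- rewrite /J mul1r take_size => Hu.
  (* The polynomials with no term dividing u form an ideal. It contains the generators and the
     powers, but not u. *)
  pose L p := forall m, (m <= mesym1 F)%MM -> p@_m = 0.
  have : L u.
    apply: gen_ideal_sub Hu.
      split=> [m _|a b La Lb m Hm|a b Lb m Hm]; first by rewrite mcoeff0.
        by rewrite mcoeffD La // Lb // addr0.
      rewrite mcoeffM big1 // => -[m1 m2] /= /eqP E.
      have le2 : ((m2 : 'X_{1..k}) <= m1 + m2)%MM by apply: lem_addl.
      by rewrite [b@__]Lb ?mulr0 //; apply: lepm_trans Hm; rewrite -E in le2.
    move=> g; rewrite mem_cat => /orP[Hg m /mnm_lepP Hm|/mapP [f Hf ->] m /mnm_lepP Hm].
      have /Hgs /(_ F Ffl) /restrict_eq0 := mem_gen_ideal Hg; apply.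
      apply/subsetP => i; rewrite inE; have := Hm i; rewrite mnmE.
      by case: (i \in F) => //; rewrite leqn0 => /eqP ->.
    apply: order_ge_pow => //.
      apply: max_gens_restrict0.
      by have [i Hi <-] := nthP 0 Hf; have [] := Hreg i Hi.
    rewrite ltnS -mdeg_mesym1 !mdegE; apply: leq_sum => i _; exact: Hm.
  move/(_ _ (lepm_refl _)); rewrite mcoeffX eqxx => /eqP.
  by rewrite oner_eq0.
(* u vanishes on every listed face not containing F, and by maximality the only one containing F is
   F itself, where p vanishes. *)
- move=> p Hp; rewrite /J take0 cats0; apply/Hgs => G Gfl.
  rewrite restrictM; have [sFG|nsFG] := boolP (F \subset G).
    by rewrite (Fmax G) // Hp mul0r.
  by rewrite [restrict G u]restrict_mesym1 (negPf nsFG) mulr0.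
Qed.

(** Discarding the variables of F one at a time gives a chain of coordinate primes from P_F to the
    maximal ideal; each inclusion is strict by the variable just discarded. *)
Lemma prime_chain_facet gs fl F :
  (forall p, gen_ideal gs p -> stanley_reisner fl p) ->
  F \in fl -> prime_chain gs #|F|.
Proof.
move=> Hgs Ffl; pose S i : {set 'I_k} := [set x in drop i (enum F)].
exists (fun i => subspace_ideal (S i)); split=> i Hi.
  split; first exact: subspace_ideal_prime.
  move=> p /Hgs /(_ F Ffl); apply: restrict_sub.
  by apply/subsetP => x; rewrite inE => /mem_drop; rewrite mem_enum.
have sz : (i < size (enum F))%N by rewrite -cardE.
case E: (drop i (enum F)) => [|x s].
  by move: sz; rewrite ltnNge -subn_eq0 -size_drop E.
have Es : drop i.+1 (enum F) = s by rewrite -addn1 addnC -drop_drop E drop1.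
split=> [p|].
  apply: restrict_sub; rewrite /S E Es; apply/subsetP => y.
  by rewrite !inE => ->; rewrite orbT.
have xs : x \notin s.
  by have := drop_uniq i (enum_uniq F); rewrite E /= => /andP[].
exists 'X_x; rewrite /subspace_ideal !restrictU !inE Es E inE eqxx.
rewrite (negPf xs); split=> // /mpolyP /(_ U_(x)%MM).
by rewrite mcoeffX eqxx mcoeff0 => /eqP; rewrite oner_eq0.
Qed.

Lemma prime_ideal_prod (Q : P -> Prop) (I : finType) (A : {set I}) (E : I -> P) :
  prime_ideal Q -> Q (\prod_(i in A) E i) -> exists2 i, i \in A & Q (E i).
Proof.
case=> _ _ _ Q1 QM; apply: (big_ind (fun p => Q p -> exists2 i, i \in A & Q (E i))) => //.
  by move=> x y IHx IHy /QM [/IHx|/IHy].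
by move=> i iA Qi; exists i.
Qed.

(** Let F index the variables outside the first prime Q_0. By primality x^F is not in Q_0, so F lies
    in a listed face. Since P_F is contained in Q_0, [chain_length_le_dim] bounds the chain by
    #|F|. *)
Lemma prime_chain_le gs fl d :
  (forall p, stanley_reisner fl p -> gen_ideal gs p) ->
  prime_chain gs d -> exists2 F, F \in fl & (d <= #|F|)%N.
Proof.
move=> Hgs [Qs [Hp Hs]].
have [S HS] : exists S : 'I_k -> bool, forall i, S i <-> ~ Qs 0%N 'X_i.
  apply: (@fin_all_exists _ (fun=> bool) (fun i b => b <-> ~ Qs 0%N 'X_i)) => i.
  by have [HQ|HQ] := classic (Qs 0%N 'X_i); [exists false|exists true]; split.
have [prime0 sub0] := Hp 0%N isT.
pose F : {set 'I_k} := [set i | S i].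
have [G Gfl sFG] : exists2 G, G \in fl & F \subset G.
  apply/hasP/negPn/negP => /hasPn HF.
  have : Qs 0%N 'X_[mesym1 F].
    apply/sub0/Hgs => G /HF /negPf nsFG.
    by rewrite restrict_mesym1 nsFG.
  rewrite mesym1X => /(prime_ideal_prod prime0) [i].
  by rewrite inE => /HS.
exists G => //; apply: leq_trans (subset_leq_card sFG).
(* An element of Q_(i+1) outside Q_i is regular modulo the prime Q_i. *)
have [y Hy] : exists y : 'I_d -> P, forall i : 'I_d, Qs i.+1 (y i) /\ ~ Qs i (y i).
  apply: (@fin_all_exists _ (fun=> P) (fun (i : 'I_d) y => Qs i.+1 y /\ ~ Qs i y)) => i.
  exact: (Hs i (ltn_ord i)).2.
have sz : size (codom y) = d by rewrite size_codom card_ord.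
have nthy i (Hi : (i < d)%N) : (codom y)`_i = y (Ordinal Hi).
  rewrite (nth_map (Ordinal Hi)) ?size_enum_ord //; congr y.
  by apply: val_inj; rewrite /= nth_enum_ord.
rewrite -[X in (X <= _)%N]sz.
apply: (@chain_length_le_dim _ Qs); rewrite ?sz.
- by move=> i /Hp [Qp _]; apply: prime_ideal_ideal.
- by move=> i /Hs [].
- by move=> i Hi; rewrite nthy; apply: (Hy (Ordinal Hi)).1.
- move=> i Hi g; rewrite nthy.
  have [[_ _ _ _ QM] _] := Hp i (ltnW Hi).
  by case/QM => // /(Hy (Ordinal Hi)).2.
- by have [[_ _ _ Q1 _] _] := Hp d (leqnn d).
move=> p HpF; have [Q0 QD QM _ _] := prime0.
rewrite [p]mpolyE; apply: ideal_sum; first exact: prime_ideal_ideal.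
move=> m _; have [sF|/subsetPn [i im iF]] := boolP (msupport m \subset F).
  by move/restrict_eq0: HpF => /(_ m sF) ->; rewrite scale0r.
have Qi : Qs 0%N 'X_i.
  by apply: NNPP => /HS; apply/negP; move: iF; rewrite inE.
have /submK <- : (U_(i) <= m)%MM by rewrite lep1mP; move: im; rewrite inE.
by rewrite mpolyXD scalerAl; apply: QM.
Qed.

Lemma elementary_symmetrics_regular_seq gs fl d :
  (forall p, gen_ideal gs p <-> stanley_reisner fl p) ->
  (0 < size fl)%N -> weakly_regular (stanley_reisner fl) (elementary_symmetrics d) ->
  regular_seq gs (elementary_symmetrics d).
Proof.
move=> Hgs fl0 W.
have mem f : f \in elementary_symmetrics d -> exists i, f = mesym k K i.+1.
  elim: d {W} => //= d IH; rewrite inE => /predU1P [->|/IH //].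
  by exists d.
split=> [i Hi|H1].
  split; last first.
    by apply: (weakly_regularP gs _).1 i Hi; apply: eq_weakly_regular W => p; rewrite Hgs.
  have [j ->] := mem _ (mem_nth 0 Hi); rewrite mesymE.
  apply: ideal_sum => [|h /eqP Hh]; first exact: gen_ideal_ideal.
  have [v vh] : exists v, v \in h by apply/card_gt0P; rewrite Hh.
  rewrite mesym1X (bigD1 v) //= mulrC.
  have [_ _ HM] := gen_ideal_ideal (max_gens K k); apply: HM.
  by apply: mem_gen_ideal; apply/mapP; exists v; rewrite ?mem_enum.
(* Properness is tested at the origin, where all generators and all the symmetric functions vanish;
   a face in [fl] ensures this for [gs]. *)
have : subspace_ideal set0 1.
  apply: gen_ideal_sub H1; first exact: subspace_ideal_ideal.
  move=> g; rewrite mem_cat => /orP [/mem_gen_ideal /Hgs Hg|/mem [j ->]].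
    case: fl fl0 {Hgs W} Hg => // F fl _ /(_ F); rewrite inE eqxx => /(_ isT).
    by apply: restrict_sub; apply: sub0set.
  rewrite /subspace_ideal mesymE restrict_sum big1 // => h /eqP Hh.
  by rewrite restrict_mesym1 subset0 -cards_eq0 Hh.
by case: (@subspace_ideal_prime set0).
Qed.

End StanleyReisner.

(** * Edge ideals: unmixed, shellable and Cohen-Macaulay graphs *)

Section EdgeIdeals.
Local Open Scope ring_scope.
Variables (K : fieldType) (T : finType) (H : graph T).
Hypothesis sH : simple_graph H.
Local Notation k := #|verts H|.
Implicit Types (F G S : {set T}) (s : seq {set T}).

Lemma independentP S :
  reflect (S \subset verts H /\ {in S &, forall x y, ~~ adj H x y}) (independent H S).
Proof.
apply: (iffP andP) => -[sS HS]; split=> //.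
  by move=> x y xS yS; move/forall_inP: HS => /(_ x xS) /forall_inP /(_ y yS).
by apply/forall_inP => x xS; apply/forall_inP => y yS; apply: HS.
Qed.

Lemma facet_sub F : maxset (independent H) F -> F \subset verts H.
Proof. by case/maxsetP => /independentP []. Qed.

Lemma exists_facet S : independent H S ->
  exists2 F, maxset (independent H) F & S \subset F.
Proof. by case/maxset_exists => F; exists F. Qed.

(** Variables are numbered by the enumeration of [verts H], so facets must be transported from [T]
    to ordinals. *)
Definition index_set F : {set 'I_k} := [set i | enum_val i \in F].

Lemma enum_val_surj v : v \in verts H -> exists i : 'I_k, enum_val i = v.
Proof. by move=> vH; exists (enum_rank_in vH v); rewrite enum_rankK_in. Qed.

Lemma enum_val_index_set F : F \subset verts H -> enum_val @: index_set F = F.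
Proof.
move=> /subsetP sF; apply/setP => v; apply/imsetP/idP => [[i]|vF].
  by rewrite inE => iF ->.
by have [i E] := enum_val_surj (sF v vF); exists i; rewrite ?inE E.
Qed.

Lemma card_index_set F : F \subset verts H -> #|index_set F| = #|F|.
Proof. by move=> /enum_val_index_set {2}<-; rewrite card_imset //; exact: enum_val_inj. Qed.

Lemma index_setS F G : F \subset verts H ->
  (index_set F \subset index_set G) = (F \subset G).
Proof.
move=> sF; apply/idP/idP => [sFG|/subsetP sFG].
  rewrite -(enum_val_index_set sF); apply/subsetP => v /imsetP [i iF ->].
  by move/subsetP: sFG => /(_ i iF); rewrite inE.
by apply/subsetP => i; rewrite !inE => /sFG.
Qed.

(** An edge monomial vanishes on each independent set. Conversely, in a polynomial vanishing on all
    facets, the support of each monomial that occurs is not independent, so an edge monomial divides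
    it. *)
Lemma edge_idealE s : (forall F, (F \in s) = maxset (independent H) F) ->
  forall p, gen_ideal (edge_gens K H) p <->
            stanley_reisner [seq index_set F | F <- s] p.
Proof.
move=> Hs p; have [_ irrH _] := sH; split=> [Hp|Hp].
  apply: gen_ideal_sub Hp; first exact: stanley_reisner_ideal.
  move=> g /allpairsPdep [i [j [_ Hj ->]]] A /mapP [F HF ->].
  rewrite restrictM !restrictU !inE.
  move: Hj; rewrite mem_filter => /andP[Hij _].
  move: HF; rewrite Hs => /maxsetP [/independentP [_ HF] _].
  case: ifP => iF; last by rewrite mul0r.
  case: ifP => jF; last by rewrite mulr0.
  by move: (HF _ _ iF jF); rewrite Hij.
rewrite [p]mpolyE; apply: ideal_sum => [|m _]; first exact: gen_ideal_ideal.
have [/hasP [A HA sA]|/hasPn HA] :=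
  boolP (has (fun A : {set 'I_k} => msupport m \subset A) [seq index_set F | F <- s]).
  have /restrict_eq0 /(_ m sA) -> := Hp A HA; rewrite scale0r.
  by case: (gen_ideal_ideal (edge_gens K H)).
have [i [j [im jm Hij]]] : exists i j : 'I_k,
    [/\ i \in msupport m, j \in msupport m & adj H (enum_val i) (enum_val j)].
  apply: NNPP => Hn.
  have /exists_facet [F HF sF] : independent H (enum_val @: msupport m).
    apply/independentP; split.
      by apply/subsetP => v /imsetP [i _ ->]; apply: enum_valP.
    move=> x y /imsetP [i im ->] /imsetP [j jm ->]; apply/negP => Hij.
    by apply: Hn; exists i, j.
  have /negP : ~~ (msupport m \subset index_set F).
    by apply: HA; apply: map_f; rewrite Hs.
  apply; apply/subsetP => i im; rewrite inE.
  by move/subsetP: sF; apply; apply: imset_f.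
have ij : i != j by apply: contraTneq Hij => ->.
have /submK <- : (U_(i) + U_(j) <= m)%MM.
  apply/mnm_lepP => l; rewrite mnmDE !mnm1E.
  move: im jm; rewrite !inE -!lt0n.
  have [<-|il] := eqVneq i l; last by case: eqVneq => // <-.
  by rewrite [j == i]eq_sym (negPf ij).
rewrite !mpolyXD scalerAl.
have [_ _ HM] := gen_ideal_ideal (edge_gens K H); apply: HM.
apply: mem_gen_ideal; apply/allpairsPdep; exists i, j; split=> //.
  by rewrite mem_enum.
by rewrite mem_filter Hij mem_enum.
Qed.

Lemma index_set_maximal s F : (forall F, (F \in s) = maxset (independent H) F) ->
  F \in s -> forall A, A \in [seq index_set F | F <- s] ->
  index_set F \subset A -> A = index_set F.
Proof.
move=> Hs; rewrite Hs => HF A /mapP [G HG ->]; move: HG; rewrite Hs.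
rewrite index_setS ?facet_sub // => /maxsetP [iG _] sFG.
by case/maxsetP: HF => _ /(_ G iG sFG) ->.
Qed.

(** Every facet has at least depth-many elements by [regular_seq_size_le]. A facet with more than
    dimension-many would give too long a chain of primes, here truncated to length d+1. *)
Lemma cohen_macaulay_unmixed : cohen_macaulay K H -> unmixed H.
Proof.
move=> [d [[[fs [<- Hfs] _]] [_ Hdim]]].
pose s := enum [set F | maxset (independent H) F].
have Hs F : (F \in s) = maxset (independent H) F by rewrite mem_enum inE.
suff E F : maxset (independent H) F -> #|F| = size fs by move=> F G /E -> /E ->.
move=> HF; have Fs : F \in s by rewrite Hs.
have sF := facet_sub HF.
have HI := edge_idealE Hs.
have Fm : index_set F \in [seq index_set F | F <- s] by apply: map_f.
apply/eqP; rewrite eqn_leq -{2}(card_index_set sF); apply/andP; split; last first.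
  exact: regular_seq_size_le HI Fm (index_set_maximal Hs Fs) Hfs.
rewrite leqNgt; apply/negP => lt_d; apply: Hdim.
have [Q [HQ1 HQ2]] := prime_chain_facet (fun p => (HI p).1) Fm.
rewrite card_index_set // in HQ1 HQ2.
exists Q; split=> i Hi; first by apply: HQ1; apply: leq_trans Hi lt_d.
by apply: HQ2; apply: leq_trans Hi lt_d.
Qed.

Lemma shellable_cohen_macaulay : unmixed H -> shellable H -> cohen_macaulay K H.
Proof.
move=> um [s [_ Hs Hsh]].
have i0 : independent H set0.
  by apply/independentP; split=> [|x y]; rewrite ?sub0set // inE.
have [F0 HF0 _] := exists_facet i0.
have F0s : F0 \in s by rewrite Hs.
have cF F : F \in s -> #|index_set F| = #|F0|.
  by rewrite Hs => HF; rewrite card_index_set ?facet_sub //; apply: um.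
have HI := edge_idealE Hs.
have F0m : index_set F0 \in [seq index_set F | F <- s] by apply: map_f.
exists #|F0|; split; split.
- exists (elementary_symmetrics K k #|F0|); split; first exact: size_elementary_symmetrics.
  apply: elementary_symmetrics_regular_seq HI _ _.
    by case: (s) F0s.
  apply: shelling_regular => [i j|A /mapP [F HF ->]]; last first.
    exact/elementary_symmetrics_regular/cF.
  rewrite size_map => /andP [ij js].
  have [|v [Hv [l lj El]]] := Hsh i j; first by rewrite ij.
  have is_ := ltn_trans ij js; have ls := ltn_trans lj js.
  have [w Ew] : exists w : 'I_k, enum_val w = v.
    apply: enum_val_surj; move: Hv; rewrite inE => /andP[_].
    by apply/subsetP/facet_sub; rewrite -Hs mem_nth.
  exists w; split; first by rewrite !(nth_map set0) // !inE Ew; move: Hv; rewrite inE.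
  exists l => //; rewrite !(nth_map set0) //; apply/setP => x.
  by rewrite !inE -(inj_eq enum_val_inj) Ew -in_setD El inE.
- move=> [fs [Efs Hfs]].
  have := regular_seq_size_le HI F0m (index_set_maximal Hs F0s) Hfs.
  by rewrite Efs cF // ltnn.
- by rewrite -(cF _ F0s); apply: prime_chain_facet F0m => p /HI.
- move/(prime_chain_le (fun p => (HI p).2)) => [A /mapP [F HF ->]].
  by rewrite cF // ltnn.
Qed.

End EdgeIdeals.

(** * Vertex decomposability and shellability *)

Section VertexDecomposable.
Variable T : finType.
Implicit Types (H : graph T) (W S A : {set T}) (x y : T).

Lemma gdel_simple H A : simple_graph H -> simple_graph (gdel H A).
Proof.
case=> symH irrH vH; split=> [x y|x|x y] /=.
- by rewrite symH; case: (adj H y x) => //=; rewrite andbC.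
- by rewrite negb_and irrH.
- by case/and3P=> /vH [xH yH] xA yA; rewrite !inE xA yA.
Qed.

Lemma independent_gdel H A S :
  independent (gdel H A) S = independent H S && [disjoint S & A].
Proof.
apply/independentP/andP => /= [[]|[/independentP [sS HS] dA]].
  rewrite subsetD => /andP[sS dA] HS; split=> //; apply/independentP; split=> //.
  move=> x y xS yS; have := HS x y xS yS.
  by rewrite (disjointFr dA xS) (disjointFr dA yS) !andbT.
split=> [|x y xS yS]; first by rewrite subsetD sS.
by rewrite negb_and HS.
Qed.

Lemma independent_sub H S A : S \subset A -> independent H A -> independent H S.
Proof.
move=> /subsetP sSA /independentP [/subsetP sA HA]; apply/independentP; split.
  by apply/subsetP => x /sSA /sA.
by move=> x y /sSA xA /sSA yA; apply: HA.
Qed.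

Section Shedding.
Variables (H : graph T) (x : T).
Hypothesis simpleH : simple_graph H.
Hypothesis xH : x \in verts H.
Hypothesis shed : forall S, independent (gdel H (cnbhd H x)) S ->
  exists2 y, adj H x y & independent (gdel H [set x]) (y |: S).

Lemma independent_link S :
  independent (gdel H (cnbhd H x)) S = (x \notin S) && independent H (x |: S).
Proof.
have [symH irrH _] := simpleH.
rewrite independent_gdel; apply/andP/andP => [[iS dS]|[xS iS]].
  have xS : x \notin S.
    by apply/negP => /(disjointFr dS); rewrite !inE eqxx.
  have nS z : z \in S -> ~~ adj H x z.
    by move=> /(disjointFr dS); rewrite !inE => /norP [].
  split=> //; case/independentP: iS => sS HS; apply/independentP; split.
    by rewrite subUset sub1set xH.
  move=> a b /setU1P [->|aS] /setU1P [->|bS]; rewrite ?irrH ?nS //.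
    by rewrite symH nS.
  exact: HS.
split; first by apply: independent_sub iS; apply: subsetUr.
case/independentP: iS => _ HS; rewrite disjoint_subset; apply/subsetP => z zS.
rewrite !inE negb_or; apply/andP; split.
  by apply: contraNneq xS => <-.
by apply: HS; rewrite !inE ?eqxx ?zS ?orbT.
Qed.

Lemma independent_deletion S :
  independent (gdel H [set x]) S = (x \notin S) && independent H S.
Proof. by rewrite independent_gdel disjoint_sym disjoints1 andbC. Qed.

(** Facets containing x come from the link. A facet of the deletion stays maximal: if x could be
    added, it would be a face of the link, and shedding would extend it by a neighbor of x within
    the deletion. *)
Lemma maxset_shedding F : maxset (independent H) F =
  if x \in F then maxset (independent (gdel H (cnbhd H x))) (F :\ x)
  else maxset (independent (gdel H [set x])) F.
Proof.
case: ifPn => xF.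
  apply/maxsetP/maxsetP => -[iF Fmax].
    split=> [|B].
      by rewrite independent_link in_setD1 eqxx setD1K.
    rewrite independent_link => /andP[xB iB] sFB.
    rewrite -(Fmax (x |: B)) ?setU1K //.
    by rewrite -(setD1K xF) setUS.
  move: iF; rewrite independent_link in_setD1 eqxx setD1K //= => iF.
  split=> // B iB sFB; have xB : x \in B by apply: (subsetP sFB).
  rewrite -(setD1K xB) -[RHS](setD1K xF) (Fmax (B :\ x)) //.
    by rewrite independent_link in_setD1 eqxx setD1K.
  exact: setSD.
apply/maxsetP/maxsetP => -[iF Fmax].
  split=> [|B]; first by rewrite independent_deletion xF.
  by rewrite independent_deletion => /andP[_]; apply: Fmax.
move: iF; rewrite independent_deletion xF /= => iF; split=> // B iB sFB.
have [xB|xB] := boolP (x \in B); last first.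
  by apply: Fmax; rewrite ?independent_deletion ?xB.
have [|y xy] := shed (S := F).
  rewrite independent_link xF; apply: independent_sub iB.
  by rewrite subUset sub1set xB.
move=> iyF; have EF := Fmax _ iyF (subsetUr _ _).
have yB : y \in B by apply: (subsetP sFB); rewrite -EF !inE eqxx.
by case/independentP: iB => _ /(_ _ _ xB yB); rewrite xy.
Qed.

Lemma shellable_shedding :
  shellable (gdel H (cnbhd H x)) -> shellable (gdel H [set x]) -> shellable H.
Proof.
move=> [s1 [U1 M1 S1]] [s2 [U2 M2 S2]].
have x1 F : F \in s1 -> x \notin F.
  by rewrite M1 => /maxsetP [+ _]; rewrite independent_link => /andP[].
have x2 F : F \in s2 -> x \notin F.
  by rewrite M2 => /maxsetP [+ _]; rewrite independent_deletion => /andP[].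
(* The facets of the deletion come first, then those of the link with x added. *)
exists (s2 ++ [seq x |: F | F <- s1]); split.
- rewrite cat_uniq U2 map_inj_in_uniq ?U1 ?andbT.
    apply/hasPn => F /mapP [F' _ ->]; apply/negP => /x2.
    by rewrite !inE eqxx.
  by move=> F F' /x1 xF /x1 xF' E; rewrite -(setU1K xF) E setU1K.
- move=> F; rewrite mem_cat M2 maxset_shedding.
  case: ifPn => xF; last first.
    case: (maxset _ F) => //=; apply/mapP => -[F' _ EF].
    by rewrite EF !inE eqxx in xF.
  have -> /= : maxset (independent (gdel H [set x])) F = false.
    by apply/negP; rewrite -M2 => /x2; rewrite xF.
  rewrite -M1; apply/mapP/idP => [[F' F's ->]|Fs]; first by rewrite setU1K ?x1.
  by exists (F :\ x) => //; rewrite setD1K.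
move=> i j; rewrite size_cat size_map => /andP[ij js].
rewrite !nth_cat; case: ltnP => j2.
  rewrite (ltn_trans ij j2); have [|v [Hv [l lj El]]] := S2 i j; first by rewrite ij.
  by exists v; split=> //; exists l; rewrite // nth_cat (ltn_trans lj j2).
have j1 : j - size s2 < size s1 by rewrite ltn_subLR.
have Fs1 := mem_nth set0 j1.
rewrite (nth_map set0) //; set F := nth set0 s1 (j - size s2) in Fs1 *.
have xF := x1 F Fs1.
case: ltnP => i2.
  (* For a pair across the two blocks, x is the new vertex, and a facet of the deletion containing F
     differs from x |: F only there. *)
  exists x; split; first by rewrite !inE eqxx (x2 _ (mem_nth _ i2)).
  have [|G HG sFG] := @exists_facet _ (gdel H [set x]) F.
    rewrite independent_deletion xF.
    move: Fs1; rewrite M1 => /maxsetP [+ _]; rewrite independent_link => /andP[_].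
    by apply: independent_sub; apply: subsetUr.
  move: HG; rewrite -M2 => HG; exists (index G s2).
    by apply: leq_trans j2; rewrite index_mem.
  rewrite nth_cat index_mem HG nth_index //; apply/setP => z; rewrite !inE.
  have [->|zx] /= := eqVneq z x; first by rewrite (x2 _ HG).
  by case: (boolP (z \in F)) => [/(subsetP sFG) ->|]; rewrite ?andbF.
have i1 : i - size s2 < size s1 by lia.
have [|v [Hv [l lj El]]] := S1 (i - size s2) (j - size s2); first by lia.
have D F' : (x |: F) :\: (x |: F') = F :\: F'.
  apply/setP => z; rewrite !inE; have [->|//] := eqVneq z x.
  by rewrite (negPf xF) andbF.
exists v; split; first by rewrite (nth_map set0) // D.
exists (size s2 + l); first by lia.
by rewrite nth_cat ltnNge leq_addr /= addKn (nth_map set0) ?D //; lia.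
Qed.

End Shedding.

Lemma vertex_decomposable_shellable H :
  simple_graph H -> vertex_decomposable H -> shellable H.
Proof.
move=> + vdH; elim: vdH => {H} [H edgeless _|H x xH _ IHlink _ IHdel shed sH].
  have indE S : independent H S = (S \subset verts H).
    by apply/independentP/idP => [[]|sS] //; split=> // x y _ _; apply: edgeless.
  exists [:: verts H]; split=> // [F|i j]; last by rewrite /=; lia.
  rewrite inE; apply/eqP/maxsetP => [->|[iF Fmax]].
    by rewrite indE; split=> // B; rewrite indE => sB sB'; apply/eqP; rewrite eqEsubset sB sB'.
  by rewrite [RHS]Fmax ?indE // -indE.
by apply: (shellable_shedding sH xH shed); [apply: IHlink|apply: IHdel];
  apply: gdel_simple.
Qed.

(** Subgraphs are indexed by vertex sets of one ambient graph, so that repeated deletions become set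
    differences. *)
Definition induced H W : graph T :=
  Graph W (fun x y => [&& adj H x y, x \in W & y \in W]).

Lemma induced_verts H : simple_graph H -> induced H (verts H) = H.
Proof.
case: H => V e [_ _ vH] /=; rewrite /induced /=; congr Graph.
apply: functional_extensionality => x; apply: functional_extensionality => y.
by apply/andP/idP => [[]//|E]; have [-> ->] := vH _ _ E.
Qed.

Lemma gdel_induced H W A : gdel (induced H W) A = induced H (W :\: A).
Proof.
rewrite /gdel /induced /=; congr Graph.
apply: functional_extensionality => x; apply: functional_extensionality => y.
rewrite !inE; case: (adj H x y) => //=.
by case: (x \in W); case: (y \in W); rewrite ?andbT ?andbF //= ?andbF.
Qed.

Lemma vertex_decomposable_induced H W x : x \in W ->
  vertex_decomposable (induced H (W :\: cnbhd H x)) ->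
  vertex_decomposable (induced H (W :\ x)) ->
  simple_graph H -> W \subset verts H ->
  (forall S, independent H S -> S \subset W :\: cnbhd H x ->
     exists y, [/\ y \in W, adj H x y & forall z, z \in S -> ~~ adj H y z]) ->
  vertex_decomposable (induced H W).
Proof.
move=> xW vd1 vd2 [symH irrH _] /subsetP sW shed.
have EW : W :\: cnbhd (induced H W) x = W :\: cnbhd H x.
  by apply/setP => z; rewrite !inE /= xW /=; case: (z \in W); rewrite ?andbF ?andbT.
apply: (vd_shedding (x := x)); rewrite ?gdel_induced ?EW // => S.
move=> /independentP /= [sS HS].
have sSW z : z \in S -> z \in W by move/(subsetP sS); rewrite inE => /andP[].
have iS : independent H S.
  apply/independentP; split=> [|a b aS bS]; first by apply/subsetP => z /sSW /sW.
  have := HS a b aS bS.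
  by rewrite (subsetP sS _ aS) (subsetP sS _ bS) !andbT.
have [y [yW xy Hy]] := shed S iS sS.
exists y; first by rewrite /= xy xW yW.
apply/independentP; split=> /= [|a b Ha Hb].
  rewrite subUset sub1set !inE yW andbT; apply/andP; split.
    by apply: contraTneq xy => ->; rewrite irrH.
  apply/subsetP => z /(subsetP sS); rewrite !inE => /andP[/norP [-> _] ->] //.
rewrite negb_and; apply/orP; left.
case/setU1P: Ha => [->|aS]; case/setU1P: Hb => [->|bS]; rewrite ?irrH ?Hy //.
  by rewrite symH Hy.
by case/independentP: iS => _; apply.
Qed.

End VertexDecomposable.

(** * Chordal graphs *)

Section SimplicialVertices.
Variable T : finType.
Implicit Types (H : graph T) (W C : {set T}) (x y v : T).

Definition simplicial_in H W s : Prop :=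
  s \in W /\ {in W &, forall a b, adj H s a -> adj H s b -> a != b -> adj H a b}.

(** The vertices v, a, q, b form a cycle of length at least four. No chord starts at v, as v has no
    neighbor in C; so a chord shortcuts the path from a to b, and descent on the length ends at the
    non-edge ab. *)
Lemma chordal_no_induced_detour_uniq H v a b C q :
  simple_graph H -> chordal H -> adj H v a -> adj H v b -> ~~ adj H a b ->
  (forall c, c \in C -> c != v /\ ~~ adj H v c) ->
  uniq (a :: rcons q b) -> path (adj H) a (rcons q b) -> {subset q <= C} -> False.
Proof.
move=> [symH irrH vH] chH va vb nab HC.
have [n] := ubnP (size q); elim: n q => // n IH q /ltnSE le_n uq pq sq.
have vnew : v \notin a :: rcons q b.
  rewrite inE mem_rcons inE !negb_or; apply/and3P; split.
  - by apply: contraTneq va => ->; rewrite irrH.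
  - by apply: contraTneq vb => ->; rewrite irrH.
  - by apply/negP => /sq /HC [/eqP].
have q0 : 0 < size q.
  by case: q pq {IH le_n uq sq vnew} => //=; rewrite (negPf nab).
have uv : uniq (v :: a :: rcons q b) by rewrite cons_uniq vnew.
have [|||i [j [/andP[ij js] ji ends Hij]]] := chH v (a :: rcons q b) uv.
- by rewrite /= size_rcons.
- move=> z; rewrite inE => /predU1P [->|]; first by case: (vH _ _ va).
  rewrite inE => /predU1P [->|]; first by case: (vH _ _ va).
  rewrite mem_rcons inE => /predU1P [->|zq]; first by case: (vH _ _ vb).
  have /splitPr E : z \in rcons q b by rewrite mem_rcons inE zq orbT.
  by case: E pq => p1 p2; rewrite cat_path /= => /and3P[_ /vH []].
- by rewrite /= va /= rcons_path pq last_rcons symH vb.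
rewrite /= size_rcons in js ends.
case: i => [|i] in ij ji ends Hij *.
  case: j => [|[|j]] // in ij js ji ends Hij *.
  move: Hij; rewrite /= nth_rcons; case: ltnP => jq; last by lia.
  by have [_ /negP] := HC _ (sq _ (mem_nth v jq)).
case: j => [|[|j]] // in ij js ji ends Hij *.
rewrite /= in Hij.
have ij' : i < j by lia.
have jq : j <= size q by lia.
have El : last a (take i q) = nth v (a :: rcons q b) i.
  rewrite (last_nth v) size_takel; last by lia.
  case: i {ends ji Hij} ij ij' => [|i] ij ij' //.
  rewrite -[LHS]/(nth v (take i.+1 q) i) -[RHS]/(nth v (rcons q b) i).
  by rewrite nth_take // nth_rcons; case: ltnP => //; lia.
(* The chord joins positions [i] and [j.+1] of [a :: rcons q b]; what lies between is cut out. *)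
pose q' := take i q ++ drop j q.
have Eq' : rcons q' b = take i q ++ drop j (rcons q b).
  by rewrite drop_rcons // rcons_cat.
have Ed : drop j (rcons q b) = nth v (rcons q b) j :: drop j.+1 (rcons q b).
  by apply: drop_nth; rewrite size_rcons.
apply: (IH q').
- by rewrite size_cat size_takel ?size_drop //; lia.
- apply: subseq_uniq uq; rewrite /= eqxx -!cats1 cat_subseq //.
  rewrite -[X in subseq _ X](cat_take_drop i) cat_subseq //.
  by rewrite -(subnK (ltnW ij')) -drop_drop drop_subseq.
- rewrite Eq' cat_path; apply/andP; split.
    by move: pq; rewrite rcons_path -{1}(cat_take_drop i q) cat_path => /andP[/andP[]].
  rewrite El Ed /= Hij /=.
  by move: pq; rewrite -{1}(cat_take_drop j (rcons q b)) cat_path Ed /= => /and3P[].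
- by move=> z; rewrite mem_cat => /orP[/mem_take|/mem_drop]; apply: sq.
Qed.

Lemma chordal_no_induced_detour H v a b C q :
  simple_graph H -> chordal H -> adj H v a -> adj H v b -> ~~ adj H a b -> a != b ->
  (forall c, c \in C -> c != v /\ ~~ adj H v c) ->
  path (adj H) a (rcons q b) -> {subset q <= C} -> False.
Proof.
move=> sH chH va vb nab ab HC pq sq.
have := last_rcons a q b; case/shortenP: pq => p pp up sp.
case/lastP: p => [|p z] in pp up sp *; first by move/eqP: ab.
rewrite last_rcons => Ez; rewrite {z}Ez in pp up sp.
apply: (chordal_no_induced_detour_uniq sH chH va vb nab HC up pp) => z zp.
have : z \in rcons q b by apply: sp; rewrite /= mem_rcons inE zp orbT.
rewrite mem_rcons inE => /predU1P [zb|]; last exact: sq.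
by move: up; rewrite /= rcons_uniq -zb zp andbF.
Qed.

(* Dirac: the neighbourhood N of a component C of the non-neighbours of v is a
   clique, so the induction hypothesis for C :|: N yields a simplicial vertex
   in C. *)
Lemma chordal_simplicial_nonneighbor H W v w :
  simple_graph H -> chordal H -> W \subset verts H ->
  v \in W -> w \in W -> w != v -> ~~ adj H v w ->
  exists s, [/\ s != v, ~~ adj H v s & simplicial_in H W s].
Proof.
move=> sH chH; have [symH irrH vH] := sH.
have [n] := ubnP #|W|; elim: n W v w => // n IH W v c0 /ltnSE le_n sW vW c0W c0v nvc0.
pose D := [set z in W | (z != v) && ~~ adj H v z].
have c0D : c0 \in D by rewrite inE c0W c0v.
pose e : rel T := [rel x y | [&& x \in D, y \in D & adj H x y]].
have sym_e x y : e x y = e y x by rewrite /e /= [adj H x y]symH andbCA.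
have csym := sym_connect_sym sym_e.
have path_D x p : path e x p -> {subset p <= D}.
  elim: p x => // y p IHp x /= /andP[/and3P[_ yD _] /IHp sp] z.
  by rewrite inE => /predU1P [->|/sp].
pose C := [set y | connect e c0 y].
have CE y : (y \in C) = connect e c0 y by rewrite inE.
have CD y : y \in C -> y \in D.
  rewrite inE => /connectP [p /path_D sp ->].
  by have := mem_last c0 p; rewrite inE => /predU1P [->|/sp].
have HC c : c \in C -> c != v /\ ~~ adj H v c.
  by move/CD; rewrite inE => /and3P[].
have C_closed c z : c \in C -> z \in D -> adj H c z -> z \in C.
  move=> cC zD cz; move: (cC); rewrite !CE => /connect_trans; apply.
  by apply: connect1; rewrite /e /= zD cz CD.
pose N := [set y in W | (y \notin C) && [exists c in C, adj H y c]].
have NP y : y \in N -> [/\ y \in W, y \notin C & exists2 c, c \in C & adj H y c].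
  by rewrite inE => /and3P[yW yC /exists_inP [c cC yc]]; split=> //; exists c.
have vN y : y \in N -> adj H v y.
  case/NP => yW yC [c cC yc]; apply: contraNT yC => nvy.
  apply: (C_closed c); rewrite 1?symH // inE yW nvy andbT.
  by apply: contraTneq yc => ->; case/HC: cC.
(* Two nonadjacent vertices of N would be joined by a path through C, a detour around v. *)
have Nclique : {in N &, forall a b, a != b -> adj H a b}.
  move=> a b aN bN ab; apply: contraT => nab; exfalso.
  have [_ _ [ca caC aca]] := NP a aN; have [_ _ [cb cbC bcb]] := NP b bN.
  have : connect e ca cb.
    by apply: (connect_trans (y := c0)); rewrite -?CE // csym -CE.
  case/connectP => p pp Ep.
  apply: (chordal_no_induced_detour (q := ca :: p) sH chH (vN a aN) (vN b bN) nab ab HC).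
    rewrite /= aca rcons_path -Ep symH bcb andbT.
    by apply: sub_path pp => x y /= /and3P[].
  move=> z zp; move: caC; rewrite !CE => /connect_trans; apply.
  exact: (path_connect pp).
pose W' := C :|: N.
have sW'W : W' \subset W.
  apply/subsetP => z /setUP [/CD|/NP []//].
  by rewrite inE => /and3P[].
have vW' : v \notin W'.
  apply/negP => /setUP [/HC [/eqP]|/vN] //.
  by rewrite (negPf (irrH v)).
have lt_n : #|W'| < n.
  apply: leq_trans le_n; apply: proper_card; rewrite properE sW'W.
  by apply/subsetPn; exists v.
have sW' : W' \subset verts H by apply: subset_trans sW.
(* All neighbors in W of a vertex of C lie in W', so being simplicial in W' is enough there. *)
suff [s sC [_ Hs]] : exists2 s, s \in C & simplicial_in H W' s.
  have [sv nvs] := HC s sC; exists s; split=> //.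
  have nbrW' z : z \in W -> adj H s z -> z \in W'.
    move=> zW sz; rewrite inE; case: (boolP (z \in C)) => //= zC.
    by rewrite inE zW zC /=; apply/exists_inP; exists s; rewrite // symH.
  split; first by apply: (subsetP sW'W); rewrite inE sC.
  by move=> a b aW bW sa sb; apply: Hs => //; apply: nbrW'.
(* If some u misses a vertex of W', induction gives a simplicial vertex not adjacent to u. It is not
   in N: for u in N because N is a clique, and for u in C because by then N is adjacent to
   everything. If no vertex misses another, W' is a clique. *)
pose nonuniversal u := [exists w in W', (w != u) && ~~ adj H u w].
have nuP u : u \in W' -> nonuniversal u ->
    exists s, [/\ s != u, ~~ adj H u s & simplicial_in H W' s].
  by move=> uW' /exists_inP [w wW' /andP[wu nuw]]; apply: (IH W' u w).
have [/exists_inP [u uN nu]|/exists_inPn HN] := boolP [exists u in N, nonuniversal u].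
  have [|s [su nus Hs]] := nuP u _ nu; first by rewrite inE uN orbT.
  exists s => //; have [/setUP [//|sN] _] := Hs.
  by case/negP: nus; apply: Nclique; rewrite // eq_sym.
have Nuniv u w : u \in N -> w \in W' -> w != u -> adj H u w.
  move=> uN wW' wu; apply: contraNT (HN u uN) => nuw.
  by apply/exists_inP; exists w; rewrite // wu.
have [/exists_inP [u uC nu]|/exists_inPn HC'] := boolP [exists u in C, nonuniversal u].
  have uW' : u \in W' by rewrite inE uC.
  have [s [su nus Hs]] := nuP u uW' nu.
  exists s => //; have [/setUP [//|sN] _] := Hs.
  by case/negP: nus; rewrite symH; apply: Nuniv; rewrite // eq_sym.
have c0C : c0 \in C by rewrite inE connect0.
exists c0 => //; split=> [|a b /setUP aW' bW' _ _ ab]; first by rewrite inE c0C.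
case: aW' => [aC|aN]; last by apply: Nuniv; rewrite // eq_sym.
apply: contraNT (HC' a aC) => nab.
by apply/exists_inP; exists b; rewrite // eq_sym ab.
Qed.

(** Passing to the nonisolated vertices of W loses no neighbor of any of them. There, either two
    vertices are nonadjacent and Dirac's argument applies, or all vertices are simplicial. *)
Lemma chordal_simplicial_edge H W x y :
  simple_graph H -> chordal H -> W \subset verts H ->
  x \in W -> y \in W -> adj H x y ->
  exists s z, [/\ simplicial_in H W s, z \in W & adj H s z].
Proof.
move=> sH chH sW xW yW xy; have [symH irrH vH] := sH.
pose W' := [set z in W | [exists u in W, adj H z u]].
have sW'W : W' \subset W by apply/subsetP => z; rewrite inE => /andP[].
have xW' : x \in W' by rewrite inE xW; apply/exists_inP; exists y.
suff [s [sW' Hs]] : exists s, simplicial_in H W' s.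
  move: (sW'); rewrite inE => /andP[sW0 /exists_inP [z zW sz]].
  exists s, z; split=> //; split=> // a b aW bW sa sb.
  by apply: Hs; rewrite // inE ?aW ?bW /=; apply/exists_inP; exists s; rewrite // symH.
have [/exists_inP [u uW' /exists_inP [w wW' /andP[wu nuw]]]|/exists_inPn Hcl] :=
  boolP [exists u in W', [exists w in W', (w != u) && ~~ adj H u w]].
  have [|s [_ _ Hs]] := chordal_simplicial_nonneighbor sH chH _ uW' wW' wu nuw.
    exact: subset_trans sW.
  by exists s.
exists x; split=> // a b aW' bW' _ _ ab; apply: contraNT (Hcl a aW') => nab.
by apply/exists_inP; exists b; rewrite // eq_sym ab.
Qed.

(** The simplicial vertex must have a neighbor, because that neighbor is the one to be shed. *)
Definition hereditarily_simplicial H W : Prop :=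
  forall W' : {set T}, W' \subset W -> {in W' &, forall x y, adj H x y ->
    exists s z, [/\ simplicial_in H W' s, z \in W' & adj H s z]}.

(** Shed a neighbor z of a simplicial vertex s. The exchange vertex is s: any neighbor of s other
    than z is adjacent to z, hence absent from S. *)
Lemma hereditarily_simplicial_vertex_decomposable H W :
  simple_graph H -> W \subset verts H -> hereditarily_simplicial H W ->
  vertex_decomposable (induced H W).
Proof.
move=> sH; have [symH irrH vH] := sH.
have [n] := ubnP #|W|; elim: n W => // n IH W /ltnSE le_n sW hW.
have [/exists_inP [x xW /exists_inP [y yW xy]]|/exists_inPn nE] :=
  boolP [exists x in W, [exists y in W, adj H x y]]; last first.
  apply: vd_edgeless => x y; apply/negP => /and3P[xy xW yW].
  by case/negP: (nE x xW); apply/exists_inP; exists y.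
have [s [z [[sW0 Hs] zW sz]]] := hW W (subxx _) x y xW yW xy.
have IH' (A : {set T}) : z \in A -> vertex_decomposable (induced H (W :\: A)).
  move=> zA; have sA : W :\: A \subset W by apply: subsetDl.
  apply: IH.
  - apply: leq_trans le_n; apply: proper_card; rewrite properE sA.
    by apply/subsetPn; exists z; rewrite // inE zA.
  - exact: subset_trans sW.
  - by move=> W' sW'; apply: hW; apply: subset_trans sA.
apply: (vertex_decomposable_induced zW) => //; try by apply: IH'; rewrite !inE eqxx.
move=> S _ /subsetP sS; exists s; rewrite symH; split=> // w /sS.
rewrite !inE negb_or => /andP[/andP[wz nzw] wW].
by apply: contra nzw => sw; apply: Hs; rewrite // eq_sym.
Qed.

End SimplicialVertices.

(** * Cycles *)

Section RootedGraphs.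
Variable T : finType.
Implicit Types (H : graph T) (S W : {set T}) (v x y : T).

(** Condition (b) of vertex decomposability phrased without deleted graphs, so that it can be
    checked in a piece and used in G'. *)
Definition sheds H v : Prop :=
  forall S, independent H S -> v \notin S -> (forall z, z \in S -> ~~ adj H v z) ->
  exists2 y, adj H v y & forall z, z \in S -> ~~ adj H y z.

Lemma simplicial_sheds H v s :
  simple_graph H -> simplicial H s -> adj H v s -> sheds H v.
Proof.
move=> [symH _ _] [_ Hs] vs S _ vS nvS; exists s => // z zS.
apply: contra (nvS z zS) => sz; apply: Hs => //; first by rewrite symH.
by apply: contraNneq vS => ->.
Qed.

(** Adjacency is spelled out without modular arithmetic, the last two cases being the wrap-around
    edge, so that [lia] decides it. Nothing is asked of [g] at k and beyond. *)
Definition cyclic_labelling H k (g : nat -> T) : Prop :=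
  [/\ forall x, x \in verts H <-> exists2 a, a < k & x = g a,
      forall a b, a < k -> b < k -> g a = g b -> a = b &
      forall a b, a < k -> b < k ->
        adj H (g a) (g b) = [|| b == a.+1, a == b.+1, (a == 0) && (b == k.-1)
                              | (b == 0) && (a == k.-1)]].

Lemma cycle_graph_labelling H v : is_cycle_graph H -> v \in verts H ->
  exists2 g, g 0 = v & cyclic_labelling H #|verts H| g /\ 3 <= #|verts H|.
Proof.
case=> k [f [k3 inj_f vE adjE]]; rewrite vE => /imsetP [i0 _ Ev].
rewrite card_imset // card_ord.
have k0 : 0 < k by lia.
(* The given labelling is rotated so that v receives label 0. *)
pose h a := Ordinal (ltn_pmod (i0 + a) k0).
have hE a : val (h a) = (i0 + a) %% k by [].
exists (fun a => f (h a)).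
  by rewrite Ev; congr f; apply: val_inj; rewrite hE addn0 modn_small.
split=> //; split.
- move=> x; split=> [|[a _ ->]]; last by rewrite vE; apply: imset_f.
  rewrite vE => /imsetP [i _ ->]; exists ((k - i0 + i) %% k); first by rewrite ltn_mod.
  congr f; apply: val_inj; rewrite hE modnDmr addnA subnKC; last by apply: ltnW.
  by rewrite modnDl modn_small.
- move=> a b ak bk /inj_f /(congr1 val); rewrite !hE => /eqP.
  by rewrite eqn_modDl !modn_small // => /eqP.
have succ a b : a < k -> b < k ->
    ((val (h a)).+1 %% k == val (h b)) = (b == a.+1) || (b == 0) && (a == k.-1).
  move=> ak bk; rewrite !hE -addn1 modnDml -addnA eqn_modDl addn1 (modn_small bk).
  have [E|ne] := eqVneq a k.-1; first by rewrite E prednK // modnn; lia.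
  by rewrite modn_small; lia.
move=> a b ak bk; rewrite adjE !succ //; lia.
Qed.

Section Labelled.
Variables (H : graph T) (k : nat) (g : nat -> T).
Hypothesis simpleH : simple_graph H.
Hypothesis gP : cyclic_labelling H k g.
Hypothesis k3 : 3 <= k.

Lemma label_exists x : x \in verts H -> exists2 a, a < k & x = g a.
Proof. by move=> xH; case: gP => + _ _ => /(_ x) [+ _]; apply. Qed.

Lemma label_verts a : a < k -> g a \in verts H.
Proof. by case: gP => E _ _ ak; apply/E; exists a. Qed.

Lemma label_inj a b : a < k -> b < k -> (g a == g b) = (a == b).
Proof.
case: gP => _ inj _ ak bk; apply/eqP/eqP => [|->] //; exact: inj.
Qed.

Lemma label_adj a b : a < k -> b < k ->
  adj H (g a) (g b) = [|| b == a.+1, a == b.+1, (a == 0) && (b == k.-1)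
                        | (b == 0) && (a == k.-1)].
Proof. by case: gP => _ _; apply. Qed.

Lemma label_neighbor a z : a < k -> adj H (g a) z ->
  exists c, [/\ c < k, z = g c & [|| c == a.+1, a == c.+1, (a == 0) && (c == k.-1)
                        | (c == 0) && (a == k.-1)]].
Proof.
move=> ak; case: simpleH => _ _ vH az; have [_ /label_exists [c ck Ez]] := vH _ _ az.
by exists c; split=> //; rewrite -label_adj // -Ez.
Qed.

(** In a triangle S is empty. In a 5-cycle only the adjacent labels 2 and 3 can occur in S, so at
    most one of them does, and it blocks only one of the two neighbors of the root. *)
Lemma cycle_sheds : k \in [:: 3; 5] -> sheds H (g 0).
Proof.
move=> k35 S /independentP [sS HS] vS nvS.
have [/exists_inP [z zS az]|/exists_inPn H1] := boolP [exists z in S, adj H (g 1) z]; last first.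
  by exists (g 1) => //; rewrite label_adj //; lia.
exists (g k.-1); first by rewrite label_adj; lia.
move=> z' z'S; apply/negP => az'.
have Hz a : g a \in S -> [/\ a <> 0, a < k -> a <> 1 & a < k -> a <> k.-1].
  move=> aS; split=> [E|ak E|ak E]; first by case/negP: vS; rewrite -E.
    by have := nvS _ aS; rewrite label_adj //; lia.
  by have := nvS _ aS; rewrite label_adj //; lia.
have [|c [ck Ec Hc]] := label_neighbor _ az; first by lia.
have [|c' [ck' Ec' Hc']] := label_neighbor _ az'; first by lia.
subst z z'; have [? ? ?] := Hz _ zS; have [? ? ?] := Hz _ z'S.
have := HS _ _ zS z'S; rewrite label_adj //; move: k35; rewrite !inE; lia.
Qed.

Lemma card_labelled S : S \subset verts H -> 
  #|S| = sumn [seq (g a \in S : nat) | a <- iota 0 k].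
Proof.
move=> /subsetP sS.
have ES : S = [set g (val i) | i in [set j : 'I_k | g j \in S]].
  apply/setP => x; apply/idP/imsetP => [xS|[i]]; last by rewrite inE => iS ->.
  have [a ak E] := label_exists (sS x xS).
  by exists (Ordinal ak); rewrite ?inE /= -?E.
rewrite {1}ES card_imset; last first.
  by move=> i j /eqP; rewrite (label_inj (ltn_ord i) (ltn_ord j)) => /eqP /val_inj.
rewrite -sum1dep_card big_mkcond sumnE big_map -[X in iota 0 X]subn0 -/(index_iota 0 k).
by rewrite big_mkord; apply: eq_bigr => i _; case: (_ \in S).
Qed.

(** Maximality means independence ([I]) and domination ([D]). On three or five labels this is a
    finite check on membership bits, giving 1 or 2 elements. *)
Lemma cycle_unmixed : k \in [:: 3; 5] -> unmixed H.
Proof.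
move=> k35.
have cardE S : maxset (independent H) S -> #|S| = k./2.
  move=> /maxsetP [iS Smax]; have /independentP [sS HS] := iS.
  have dom a : a < k -> (g a \in S) || [exists z in S, adj H (g a) z].
    move=> ak; apply/norP => -[aS /exists_inPn Ha]; case/negP: aS.
    rewrite -(Smax (g a |: S)) ?setU11 ?subsetUr //; case: simpleH => symH irrH _.
    apply/independentP; split; first by rewrite subUset sub1set label_verts.
    move=> x y /setU1P [->|xS] /setU1P [->|yS]; rewrite ?irrH ?Ha //.
      by rewrite symH Ha.
    exact: HS.
  have ak c : c \in iota 0 k -> c < k by rewrite mem_iota.
  pose e a b := [|| b == a.+1, a == b.+1, (a == 0) && (b == k.-1)
                  | (b == 0) && (a == k.-1)].
  have D : all (fun a => has (fun c => (g c \in S) && ((c == a) || e a c)) (iota 0 k))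
               (iota 0 k).
    apply/allP => a /ak ak'; apply/hasP.
    case/orP: (dom a ak') => [aS|/exists_inP [z zS /(label_neighbor ak')]].
      by exists a; rewrite ?mem_iota // aS eqxx.
    by case=> c [ck Ec Hc]; exists c; rewrite ?mem_iota // -Ec zS /e Hc orbT.
  have I : all (fun a => all (fun b => ~~ [&& g a \in S, g b \in S & e a b]) (iota 0 k))
               (iota 0 k).
    apply/allP => a /ak ak'; apply/allP => b /ak bk; apply/and3P => -[aS bS].
    by apply/negP; rewrite /e -label_adj //; apply: HS.
  rewrite card_labelled //; move: k35 D I; rewrite /e !inE => /orP[] /eqP ->;
  rewrite /=; case: (g 0 \in S); case: (g 1 \in S); case: (g 2 \in S) => //=;
  by case: (g 3 \in S); case: (g 4 \in S).
by move=> S1 S2 /cardE -> /cardE ->.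
Qed.

(** Without the root the cycle is a path. The least label whose successor label is also in W belongs
    to a leaf, and a leaf is simplicial. *)
Lemma cycle_deletion_simplicial :
  hereditarily_simplicial H (verts H :\ g 0).
Proof.
move=> W sW x y xW yW xy.
have labW z : z \in W -> exists2 a, 0 < a < k & z = g a.
  move/(subsetP sW); rewrite !inE => /andP[z0 /label_exists [a ak Ez]].
  by exists a; rewrite // ak andbT lt0n; apply: contraNneq z0 => E; rewrite Ez E.
have ex : exists a, [&& 0 < a, a.+1 < k, g a \in W & g a.+1 \in W].
  have [a /andP[a0 ak] Ex] := labW x xW; have [b /andP[b0 bk] Ey] := labW y yW.
  move: xy; rewrite Ex Ey label_adj // => Hab.
  have [E|E] : b = a.+1 \/ a = b.+1 by lia.
    by exists a; rewrite a0 -E -Ex -Ey bk xW yW.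
  by exists b; rewrite b0 -E -Ex -Ey ak xW yW.
case: (ex_minnP ex) => a /and4P[a0 ak aW aW1] amin.
exists (g a), (g a.+1); split=> //; last by rewrite label_adj ?eqxx //; lia.
have uniq_nbr z : z \in W -> adj H (g a) z -> z = g a.+1.
  move=> zW az; have [c /andP[c0 ck] Ez] := labW z zW.
  move: az; rewrite Ez label_adj //; last by lia.
  move=> Hc; have [->//|Eac] : c = a.+1 \/ a = c.+1 by lia.
  have := amin c; rewrite c0 -Eac aW -Ez zW; lia.
split=> // b c bW cW /(uniq_nbr b bW) -> /(uniq_nbr c cW) ->.
by rewrite eqxx.
Qed.

End Labelled.
End RootedGraphs.

(** * Attaching graphs *)

Section Attached.
Variables (T : finType) (n : nat) (G : graph T) (r : 'I_n -> T) (Hs : 'I_n -> graph T).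
Hypothesis simpleG : simple_graph G.
Hypothesis inj_r : injective r.
Hypothesis vertsG : verts G = [set r i | i : 'I_n].
Hypothesis simpleH : forall i, simple_graph (Hs i).
Hypothesis rootH : forall i, r i \in verts (Hs i).
Hypothesis disjH : forall i j : 'I_n, i != j ->
  [disjoint verts (Hs i) :\ r i & verts (Hs j) :\ r j].
Hypothesis disjG : forall i, [disjoint verts (Hs i) :\ r i & verts G].
Implicit Types (i j : 'I_n) (x y z : T) (A B C F S W : {set T}).

Local Notation G' := (attach G Hs).
Local Notation V i := (verts (Hs i)).

Lemma root_vertsG i : r i \in verts G.
Proof. by rewrite vertsG imset_f. Qed.

Lemma in_vertsG i x : x \in V i -> x \in verts G -> x = r i.
Proof.
move=> xi xG; apply/eqP; have := disjointFl (disjG i) xG.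
by rewrite !inE xi andbT => /negbFE.
Qed.

Lemma in_verts_inj i j x : x \in V i -> x \in V j -> i = j.
Proof.
move=> xi xj; have [xG|xG] := boolP (x \in verts G).
  by apply: inj_r; rewrite -(in_vertsG xi xG) -(in_vertsG xj xG).
apply/eqP; apply: contraT => ij.
have ne l : x != r l by apply: contraNneq xG => ->; apply: root_vertsG.
have xi' : x \in V i :\ r i by rewrite !inE ne.
by have := disjointFr (disjH ij) xi'; rewrite !inE ne xj.
Qed.

Lemma attach_adj i x y : x \in V i -> x != r i -> adj G' x y = adj (Hs i) x y.
Proof.
move=> xi xr; apply/idP/idP => [/= /orP[Gxy|/existsP [j Hxy]]|Hxy].
- by case/eqP: xr; apply: in_vertsG xi _; case: simpleG => _ _ /(_ _ _ Gxy) [].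
- have xj : x \in V j by case: (simpleH j) => _ _ /(_ _ _ Hxy) [].
  by rewrite (in_verts_inj xi xj).
- by apply/orP; right; apply/existsP; exists i.
Qed.

Lemma attach_verts x : x \in verts G' <-> exists i, x \in V i.
Proof.
split=> [|[i xi]]; last by rewrite inE; apply/orP; right; apply/bigcupP; exists i.
rewrite inE => /orP[|/bigcupP [i _ xi]]; last by exists i.
by rewrite vertsG => /imsetP [i _ ->]; exists i.
Qed.

Lemma attach_simple : simple_graph G'.
Proof.
case: simpleG => symG irrG vG; split=> [x y|x|x y] /=.
- rewrite symG; congr (_ || _); apply: eq_existsb => i.
  by case: (simpleH i).
- rewrite negb_or irrG; apply/existsPn => i; by case: (simpleH i).
- case/orP => [/vG [xG yG]|/existsP [i xy]]; first by rewrite !inE xG yG.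
  by case: (simpleH i) => _ _ /(_ _ _ xy) [xi yi]; split; apply/attach_verts; exists i.
Qed.

(** Each piece is induced in G', since it meets G in its root only. *)
Lemma attach_adj_in i x y : x \in V i -> y \in V i -> adj G' x y = adj (Hs i) x y.
Proof.
move=> xi yi; have [symG' irrG' _] := attach_simple.
have [symH irrH _] := simpleH i.
have [Ex|xr] := eqVneq x (r i); last exact: attach_adj.
have [Ey|yr] := eqVneq y (r i); last by rewrite symG' symH; apply: attach_adj.
by rewrite Ex Ey (negPf (irrG' _)) (negPf (irrH _)).
Qed.

Lemma attach_nonroot_neighbor i x y : x \in V i -> x != r i -> adj G' x y -> y \in V i.
Proof.
move=> xi xr; rewrite (attach_adj _ xi xr) => xy.
by case: (simpleH i) => _ _ /(_ _ _ xy) [].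
Qed.

Lemma attach_root_neighbor i j y : adj G' (r i) y -> y \in V j -> j != i -> y = r j.
Proof.
have [symG' _ _] := attach_simple.
move=> iy yj ji; apply/eqP; apply: contraT => yr.
have ij : r i \in V j by apply: (attach_nonroot_neighbor yj yr); rewrite symG'.
by case/eqP: ji; apply: in_verts_inj ij (rootH i).
Qed.

Lemma independent_component i S : independent G' S -> independent (Hs i) (S :&: V i).
Proof.
move=> /independentP [_ HS]; apply/independentP; split; first exact: subsetIr.
move=> x y /setIP [xS xi] /setIP [yS yi].
by rewrite -(attach_adj_in xi yi) HS.
Qed.

Lemma independent_attach i S B : independent (Hs i) S -> r i \notin S ->
  independent G' B -> [disjoint B & V i] -> independent G' (S :|: B).
Proof.
move=> /independentP [/subsetP sS HS] rS /independentP [sB HB] dB.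
have [symG' _ _] := attach_simple.
have SB x y : x \in S -> y \in B -> ~~ adj G' x y.
  move=> xS yB; apply/negP => xy; case/negP: (disjointFr dB yB).
  by apply: attach_nonroot_neighbor xy; [apply: sS|apply: contraNneq rS => <-].
apply/independentP; split.
  rewrite subUset sB andbT; apply/subsetP => x /sS xi.
  by apply/attach_verts; exists i.
move=> x y /setUP [xS|xB] /setUP [yS|yB].
- by rewrite (attach_adj_in (sS x xS) (sS y yS)) HS.
- exact: SB.
- by rewrite symG' SB.
- exact: HB.
Qed.

Lemma attach_vertex_decomposable :
  (forall i, sheds (Hs i) (r i)) ->
  (forall i, hereditarily_simplicial (Hs i) (V i :\ r i)) ->
  vertex_decomposable G'.
Proof.
move=> shH hsH; have [symG' irrG' vG'] := attach_simple.
rewrite -(induced_verts attach_simple).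
(* The invariant is that a surviving root still has its whole piece. It persists when r i or its
   closed neighborhood is removed, as r i meets other pieces only in their roots. *)
suff vd W : W \subset verts G' -> (forall i, r i \in W -> V i \subset W) ->
    vertex_decomposable (induced G' W).
  apply: vd => // i _; apply/subsetP => x xi.
  by apply/attach_verts; exists i.
have [N] := ubnP #|W|; elim: N W => // N IH W /ltnSE le_N sW rootW.
have [/existsP [i riW]|/existsPn noroot] := boolP [exists i, r i \in W].
  have lt_N A : r i \in A -> #|W :\: A| < N.
    move=> rA; apply: leq_trans le_N; apply: proper_card; rewrite properE subsetDl.
    by apply/subsetPn; exists (r i); rewrite // inE rA.
  have Vi := subsetP (rootW i riW).
  have keep A : A \subset cnbhd G' (r i) -> r i \in A ->
      vertex_decomposable (induced G' (W :\: A)).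
    move=> sA rA; apply: IH; first exact: lt_N.
      exact: subset_trans (subsetDl _ _) sW.
    move=> j /setDP [rjW rjA]; apply/subsetP => x xj; rewrite inE.
    rewrite (subsetP (rootW j rjW) _ xj) andbT; apply: contra (rjA) => xA.
    have ji : j != i by apply: contraNneq rjA => ->.
    have := subsetP sA _ xA; rewrite !inE => /orP[/eqP xr|ix].
      by case/eqP: ji; apply: in_verts_inj xj _; rewrite xr.
    by rewrite -(attach_root_neighbor ix xj ji).
  apply: (vertex_decomposable_induced riW) => //; try exact: attach_simple.
  - by apply: keep; rewrite // !inE eqxx.
  - by apply: keep; rewrite ?inE // sub1set !inE eqxx.
  move=> S iS /subsetP sS.
  have SW z : z \in S -> [/\ z != r i, ~~ adj G' (r i) z & z \in W].
    by move/sS; rewrite !inE negb_or => /andP[/andP[-> ->] ->].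
  have [||y iy Hy] := shH i (S :&: V i) (independent_component i iS).
  - by apply/negP => /setIP [/SW [/eqP]].
  - by move=> z /setIP [/SW [_ + _] zi]; rewrite (attach_adj_in (rootH i) zi).
  have yi : y \in V i by case: (simpleH i) => _ _ /(_ _ _ iy) [].
  have yr : y != r i.
    by apply: contraTneq iy => ->; case: (simpleH i) => _ /(_ (r i)).
  exists y; split; first exact: Vi.
    by rewrite (attach_adj_in (rootH i) yi).
  move=> z zS; apply/negP => yz.
  have zi := attach_nonroot_neighbor yi yr yz.
  by have := Hy z; rewrite inE zS zi -(attach_adj_in yi zi) yz => /(_ isT).
(* With no root left, every edge stays inside one piece, so its simplicial vertex is simplicial in
   the whole. *)
apply: (hereditarily_simplicial_vertex_decomposable attach_simple sW).
move=> W' sW' x y xW' yW' xy.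
have nr i z : z \in W' -> z != r i.
  by move=> zW'; apply: contraNneq (noroot i) => <-; apply: (subsetP sW').
have [i xi] : exists i, x \in V i by apply/attach_verts; case: (vG' _ _ xy).
have yi := attach_nonroot_neighbor xi (nr i x xW') xy.
have sWi : W' :&: V i \subset V i :\ r i.
  by apply/subsetP => z /setIP [zW' zi]; rewrite !inE nr.
have [|||s [z [[/setIP [sW0 si] Hss] /setIP [zW zi] sz]]] := hsH i _ sWi x y.
- by rewrite inE xW'.
- by rewrite inE yW'.
- by rewrite -(attach_adj_in xi yi).
exists s, z; split=> //; last by rewrite (attach_adj_in si zi).
split=> // a b aW bW sa sb ab.
have ai := attach_nonroot_neighbor si (nr i s sW0) sa.
have bi := attach_nonroot_neighbor si (nr i s sW0) sb.
rewrite (attach_adj_in ai bi); apply: Hss; rewrite ?inE ?aW ?bW //.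
  by rewrite -(attach_adj_in si ai).
by rewrite -(attach_adj_in si bi).
Qed.

(* Shedding makes the trace of a maximal independent set on each component
   maximal, so that its size is the sum of the independence numbers. *)
Lemma attach_unmixed :
  (forall i, sheds (Hs i) (r i)) -> (forall i, unmixed (Hs i)) -> unmixed G'.
Proof.
move=> shH umH; have [symG' irrG' vG'] := attach_simple.
have trace F i : maxset (independent G') F -> maxset (independent (Hs i)) (F :&: V i).
  move=> /maxsetP [iF Fmax]; have [symH irrH vH] := simpleH i.
  apply/maxsetP; split; first exact: independent_component.
  move=> B /independentP [/subsetP sB HB] sFB; apply/eqP; rewrite eqEsubset sFB andbT.
  (* A nonroot vertex has all its G'-neighbors in its piece, so whatever excludes it from F lies in
     the trace. *)
  have dominated z : z \in V i -> z != r i -> z \notin F ->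
      exists2 t, t \in F :&: V i & adj (Hs i) z t.
    move=> zi zr zF; apply/exists_inP; apply: contraNT zF => /exists_inPn nz.
    have zz : independent (Hs i) [set z].
      apply/independentP; split=> [|a b /set1P -> /set1P -> //]; by rewrite sub1set.
    rewrite -(Fmax (z |: F)) ?setU11 ?subsetUr //.
    have zF' t : t \in F -> ~~ adj G' z t.
      move=> tF; apply/negP => zt; have ti := attach_nonroot_neighbor zi zr zt.
      by have := nz t; rewrite inE tF ti -(attach_adj _ zi zr) zt => /(_ isT).
    case/independentP: iF => sF HF; apply/independentP; split.
      by rewrite subUset sub1set sF andbT; apply/attach_verts; exists i.
    move=> a b /setU1P [->|aF] /setU1P [->|bF]; rewrite ?irrG' ?zF' //.
      by rewrite symG' zF'.
    exact: HF.
  apply/subsetP => z zB; have zi := sB z zB; rewrite inE zi andbT.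
  apply: contraT => zF.
  have noB t : t \in F :&: V i -> ~~ adj (Hs i) z t.
    by move=> tF; apply: HB => //; apply: (subsetP sFB).
  have [Ez|zr] := eqVneq z (r i); last first.
    by have [t tF] := dominated z zi zr zF; rewrite (negPf (noB t tF)).
  (* If the root could be added, shedding gives a neighbor y of it with no neighbor in the trace.
     Then y is in F, as nonroot vertices are dominated, and it conflicts with the root. *)
  subst z; have [||y iy Hy] := shH i _ (independent_component i iF) => //.
    by rewrite inE (negPf zF).
  have yi : y \in V i by case: (vH _ _ iy).
  have yr : y != r i by apply: contraTneq iy => ->; rewrite irrH.
  have [yF|yF] := boolP (y \in F).
    by have := noB y; rewrite inE yF yi iy => /(_ isT).
  by have [t tF] := dominated y yi yr yF; rewrite (negPf (Hy t tF)).
have card F : F \subset verts G' -> #|F| = \sum_i #|F :&: V i|.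
  move=> sF; have -> : F = \bigcup_i (F :&: V i).
    apply/setP => x; apply/idP/bigcupP => [xF|[i _ /setIP []//]].
    have [i xi] := (attach_verts x).1 (subsetP sF x xF).
    by exists i; rewrite // inE xF.
  have H1 i : (\bigcup_i (F :&: V i)) :&: V i = F :&: V i.
    apply/setP => x; rewrite !inE; apply/andP/andP => [[/bigcupP [j _ /setIP []//]]|].
    by case=> xF xi; split=> //; apply/bigcupP; exists i; rewrite // inE xF.
  under [RHS]eq_bigr do rewrite H1.
  rewrite -sum1_card; under [RHS]eq_bigr do rewrite -sum1_card.
  rewrite partition_disjoint_bigcup //= => i j ij.
  rewrite -setI_eq0; apply/eqP/setP => x; rewrite !inE.
  apply/negP => /andP[/andP[_ xi] /andP[_ xj]].
  by case/eqP: ij; apply: in_verts_inj xi xj.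
move=> F1 F2 m1 m2; rewrite !card ?facet_sub //.
by apply: eq_bigr => i _; apply: umH; apply: trace.
Qed.

Lemma independent_card_le (F S : {set T}) : unmixed G' ->
  maxset (independent G') F -> independent G' S -> #|S| <= #|F|.
Proof.
move=> um mF /exists_facet [F' mF' /subset_leq_card].
by rewrite (um _ _ mF mF').
Qed.

(** Let B0 be maximal among independent sets outside the piece. A facet of the piece avoiding the
    root completes B0 to a facet of G', which fixes its size. Facets containing the root are
    compared with these by exchanges in both directions. *)
Lemma attach_unmixed_simplicial i s : unmixed G' ->
  simplicial (Hs i) s -> adj (Hs i) (r i) s -> unmixed (Hs i).
Proof.
move=> um [sV Hs_s] rs; have [symH irrH vH] := simpleH i.
have [symG' irrG' vG'] := attach_simple.
have sr : s != r i by apply: contraTneq rs => ->; rewrite irrH.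
have i0 : independent G' set0.
  by apply/independentP; split=> [|x y]; rewrite ?sub0set // inE.
have [F0 mF0 _] := exists_facet i0.
pose outer B := independent G' B && [disjoint B & V i].
have [B0 mB0 _] : {B | maxset outer B & set0 \subset B}.
  by apply: maxset_exists; rewrite /outer i0 -setI_eq0 set0I eqxx.
have /maxsetP [/andP[iB0 dB0] B0max] := mB0.
have is1 : independent (Hs i) [set s].
  apply/independentP; split=> [|a b /set1P -> /set1P -> //]; by rewrite sub1set.
have disjE B : [disjoint B & V i] -> forall S, S \subset V i ->
    #|S :|: B| = #|S| + #|B|.
  move=> dB S sS; rewrite cardsU (_ : S :&: B = set0) ?cards0 ?subn0 //.
  apply/setP => x; rewrite !inE; apply/negP => /andP[/(subsetP sS) xi xB].
  by rewrite (disjointFr dB xB) in xi.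
have avoiding S : maxset (independent (Hs i)) S -> r i \notin S ->
    #|S| + #|B0| = #|F0|.
  move=> /maxsetP [iS Smax] rS; have /independentP [sS HS] := iS.
  rewrite -disjE //; apply: um => //; apply/maxsetP; split.
    exact: independent_attach iS rS iB0 dB0.
  move=> C iC; rewrite subUset => /andP[sSC sBC].
  have EC1 : C :&: V i = S.
    by apply: Smax; rewrite ?independent_component // subsetI sSC.
  have EC2 : C :\: V i = B0.
    apply: B0max; last by rewrite subsetD sBC.
    rewrite /outer (independent_sub _ iC) ?subsetDl //=.
    by rewrite -setI_eq0 setIDAC setDIl setDv setI0.
  by rewrite -[LHS](setID C (V i)) EC1 EC2.
have [S0 mS0 sS0] := exists_facet is1.
have sS0' : s \in S0 by rewrite -sub1set.
have rS0 : r i \notin S0.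
  apply/negP => rS0; case/maxsetP: mS0 => /independentP [_ HS0] _.
  by have := HS0 _ _ rS0 sS0'; rewrite rs.
have /maxsetP [iS0 _] := mS0.
have E0 := avoiding S0 mS0 rS0.
have containing S : maxset (independent (Hs i)) S -> r i \in S ->
    #|S| + #|B0| = #|F0|.
  move=> /maxsetP [iS Smax] riS; have /independentP [sS HS] := iS.
  have sS1 : s \notin S.
    by apply/negP => sS1; have := HS _ _ riS sS1; rewrite rs.
  apply/eqP; rewrite eqn_leq; apply/andP; split.
    (* Trading the root for s keeps the size and independence, and S1 can be joined to B0. *)
    pose S1 := s |: (S :\ r i).
    have nsS t : t \in S -> t != r i -> ~~ adj (Hs i) s t.
      move=> tS tr; apply/negP => st.
      have := HS _ _ riS tS; rewrite Hs_s // 1?eq_sym // symH //.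
    have iS1 : independent (Hs i) S1.
      apply/independentP; split.
        by rewrite subUset sub1set sV; apply: subset_trans sS; apply: subsetDl.
      move=> a b /setU1P [->|/setD1P [ar aS]] /setU1P [->|/setD1P [br bS]];
        rewrite ?irrH ?nsS //.
        by rewrite symH nsS.
      exact: HS.
    have rS1 : r i \notin S1 by rewrite !inE eqxx eq_sym (negPf sr).
    have -> : #|S| = #|S1|.
      by rewrite (cardsD1 (r i)) riS cardsU1 !inE (negPf sS1) andbF.
    rewrite -disjE //; last by case/independentP: iS1.
    exact: independent_card_le um mF0 (independent_attach iS1 rS1 iB0 dB0).
  have iSG : independent G' S.
    apply/independentP; split=> [|x y xS yS].
      by apply/subsetP => x /(subsetP sS) xi; apply/attach_verts; exists i.
    by rewrite (attach_adj_in (subsetP sS x xS) (subsetP sS y yS)) HS.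
  (* Extend S to a facet F of G'. Replacing its trace S by S0, which avoids the root, leaves an
     independent set, so S0 is no larger than S. *)
  have [F mF sSF] := exists_facet iSG; have /maxsetP [iF _] := mF.
  have ES : F :&: V i = S.
    by apply: Smax; rewrite ?independent_component // subsetI sSF.
  have dB : [disjoint F :\: V i & V i].
    by rewrite -setI_eq0 setIDAC setDIl setDv setI0.
  have iB : independent G' (F :\: V i) by apply: independent_sub iF; apply: subsetDl.
  have := independent_card_le um mF0 (independent_attach iS0 rS0 iB dB).
  rewrite disjE //; last by case/independentP: iS0.
  have EF : #|F0| = #|S| + #|F :\: V i| by rewrite (um _ _ mF0 mF) -ES cardsID.
  by rewrite {2}EF leq_add2l -E0 leq_add2l => H1; rewrite H1.
have all S : maxset (independent (Hs i)) S -> #|S| + #|B0| = #|F0|.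
  by have [riS|riS] := boolP (r i \in S); [move/containing|move/avoiding]; apply.
by move=> S1 S2 /all E1 /all; rewrite -E1 => /addIn.
Qed.

(** For length 4 or at least 6, some facet contains g 2 and can exchange it for both g 1 and g 3,
    which contradicts unmixedness. *)
Lemma attach_unmixed_cycle i j : unmixed G' -> adj G (r i) (r j) ->
  is_cycle_graph (Hs i) -> #|V i| \in [:: 3; 5].
Proof.
move=> um rij cH; have [symG' irrG' vG'] := attach_simple.
have [g g0 [gP k3]] := cycle_graph_labelling cH (rootH i).
set k := #|V i| in gP k3 *; apply: contraT; rewrite !inE => k35.
have k4 : 3 < k by move: k3 k35; clear; lia.
have k6 : 4 < k -> 5 < k by move: k35; clear; lia.
have k1 : 1 < k by apply: leq_trans k4.
have k2 : 2 < k by apply: leq_trans k4.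
have ij : i != j by apply: contraTneq rij => ->; case: simpleG => _ /(_ (r j)).
have rij' : adj G' (r i) (r j) by rewrite /= rij.
have gV a : a < k -> g a \in V i by apply: label_verts gP _.
have gr a : 0 < a -> a < k -> g a != r i.
  by move=> a0 ak; rewrite -g0 (label_inj gP) -?lt0n //; apply: leq_trans ak.
have gadj a b : a < k -> b < k -> adj G' (g a) (g b) =
    [|| b == a.+1, a == b.+1, (a == 0) && (b == k.-1) | (b == 0) && (a == k.-1)].
  by move=> ak bk; rewrite (attach_adj_in (gV a ak) (gV b bk)) (label_adj gP).
have gnbr a z : 0 < a -> a < k -> adj G' (g a) z ->
    exists c, [/\ c < k, z = g c & [|| c == a.+1, a == c.+1 | (c == 0) && (a == k.-1)]].
  move=> a0 ak; rewrite (attach_adj _ (gV a ak) (gr a a0 ak)) => az.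
  have [c [ck Ez Hc]] := label_neighbor (simpleH i) gP ak az.
  by exists c; split=> //; move: a0 Hc; clear; lia.
(* r j keeps the root g 0 out of the facet, and g 5 keeps g 4 out. For length 4 neither g 4 nor g 5
   is a label, so g 5 is omitted. *)
pose X := [set x | [|| x == r j, x == g 2 | (5 < k) && (x == g 5)]].
have rjV : r j \notin V i.
  by apply: contra ij => rji; rewrite (in_verts_inj rji (rootH j)).
have jg a : 0 < a -> a < k -> ~~ adj G' (g a) (r j).
  by move=> a0 ak; apply: contra rjV; apply: attach_nonroot_neighbor (gV a ak) (gr a a0 ak).
have iX : independent G' X.
  have XP x : x \in X -> x = r j \/ exists a, [/\ a < k, x = g a & (a == 2) || (a == 5)].
    rewrite inE => /or3P[/eqP|/eqP|/andP[k5 /eqP]] E; [left|right|right] => //.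
      by exists 2.
    by exists 5.
  apply/independentP; split.
    apply/subsetP => x /XP [->|[a [ak -> _]]]; apply/attach_verts.
      by exists j.
    by exists i; apply: gV.
  move=> x y /XP [->|[a [ak -> Ha]]] /XP [->|[b [bk -> Hb]]].
  - exact: irrG'.
  - by rewrite symG' jg //; case/orP: Hb => /eqP ->.
  - by rewrite jg //; case/orP: Ha => /eqP ->.
  - by rewrite gadj //; move: Ha Hb; clear; lia.
have [F mF sXF] := exists_facet iX; have /maxsetP [/independentP [sF HF] _] := mF.
have rjF : r j \in F by apply: (subsetP sXF); rewrite inE eqxx.
have g2F : g 2 \in F by apply: (subsetP sXF); rewrite inE eqxx orbT.
have notF a b : a < k -> b < k -> g a \in F -> (b == a.+1) || (a == b.+1) -> g b \notin F.
  move=> ak bk aF ab; apply/negP => bF; have := HF _ _ aF bF.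
  by rewrite gadj // orbA ab.
have g0F : g 0 \notin F.
  by apply/negP; rewrite g0 => riF; have := HF _ _ riF rjF; rewrite rij'.
have g1F : g 1 \notin F by apply: (notF 2).
have g3F : g 3 \notin F by apply: (notF 2).
have g4F : 4 < k -> g 4 \notin F.
  move=> lt4; apply: (notF 5); rewrite ?k6 //.
  by apply: (subsetP sXF); rewrite inE eqxx k6 ?orbT.
have H1 z : z \in F :\ g 2 -> ~~ adj G' (g 1) z.
  rewrite !inE => /andP[z2 zF]; apply/negP => /gnbr [||c [ck Ez Hc]] //.
  have [E|E] : c = 2 \/ c = 0 by move: Hc; clear; lia.
    by rewrite Ez E eqxx in z2.
  by rewrite Ez E (negPf g0F) in zF.
have H3 z : z \in F :\ g 2 -> ~~ adj G' (g 3) z.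
  rewrite !inE => /andP[z2 zF]; apply/negP => /gnbr [||c [ck Ez Hc]] //.
  have [E|[E|E]] : c = 4 \/ c = 2 \/ c = 0 by move: Hc; clear; lia.
  - by rewrite E in ck; rewrite Ez E (negPf (g4F ck)) in zF.
  - by rewrite Ez E eqxx in z2.
  - by rewrite Ez E (negPf g0F) in zF.
have n13 : ~~ adj G' (g 1) (g 3) by rewrite gadj // /=; move: k4; clear; lia.
pose F' := g 1 |: (g 3 |: (F :\ g 2)).
have iF' : independent G' F'.
  apply/independentP; split.
    rewrite !subUset !sub1set; apply/and3P; split.
    - by apply/attach_verts; exists i; apply: gV.
    - by apply/attach_verts; exists i; apply: gV.
    - by apply: subset_trans sF; apply: subsetDl.
  move=> x y /setU1P [->|/setU1P [->|xF]] /setU1P [->|/setU1P [->|yF]] //.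
  - exact: H1.
  - by rewrite symG'.
  - exact: H3.
  - by rewrite symG' H1.
  - by rewrite symG' H3.
  - by move: xF yF => /setD1P [_ xF] /setD1P [_ yF]; apply: HF.
have := independent_card_le um mF iF'.
have g13 : g 1 != g 3 by rewrite (label_inj gP).
rewrite /F' !cardsU1 !inE (negPf g13) (negPf g1F) (negPf g3F) !andbF /=.
by rewrite [#|F|](cardsD1 (g 2)) g2F ltnn.
Qed.

End Attached.

(* Vertices live in an ambient finite type T.  The vertices of G are
   x_{i1} = r i (i < n, 0-indexed); the graph attached at r i is Hs i:
   a cycle graph C_i for i < m, a connected chordal graph G_i for m <= i < n. *)
Theorem theorem3p5 (K : fieldType) (T : finType) (n m : nat)
  (G : graph T) (r : 'I_n -> T) (Hs : 'I_n -> graph T) :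
  simple_graph G ->
  injective r ->
  verts G = [set r i | i : 'I_n] ->
  no_isolated_vertex G ->
  (m <= n)%N ->
  (forall i, simple_graph (Hs i)) ->
  (forall i, r i \in verts (Hs i)) ->
  (forall i : 'I_n, (i < m)%N -> is_cycle_graph (Hs i)) ->
  (forall i : 'I_n, (m <= i)%N ->
     [/\ connected_graph (Hs i), chordal (Hs i), (2 <= #|verts (Hs i)|)%N &
         exists2 s, simplicial (Hs i) s & adj (Hs i) (r i) s]) ->
  (forall i j : 'I_n, i != j ->
     [disjoint verts (Hs i) :\ r i & verts (Hs j) :\ r j]) ->
  (forall i, [disjoint verts (Hs i) :\ r i & verts G]) ->
  let G' := attach G Hs in
  [/\ unmixed G' <-> cohen_macaulay K G',
      unmixed G' <-> unmixed G' /\ shellable G',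
      unmixed G' <-> unmixed G' /\ vertex_decomposable G' &
      unmixed G' <->
        (forall i : 'I_n, (i < m)%N -> #|verts (Hs i)| \in [:: 3; 5]%N) /\
        (forall i : 'I_n, (m <= i)%N -> unmixed (Hs i))].
Proof.
move=> sG inj_r vG isoG _ sH rH cycH chH disH disG G'.
have [_ _ vG_adj] := sG.
have sG' : simple_graph G' by exact: attach_simple sG vG sH rH.
have sheds_root (i : 'I_n) :
    (i < m -> #|verts (Hs i)| \in [:: 3; 5]) -> sheds (Hs i) (r i).
  move=> c35; have [im|mi] := ltnP i m.
    have [g <- [gP k3]] := cycle_graph_labelling (cycH i im) (rH i).
    exact: cycle_sheds (sH i) gP k3 (c35 im).
  have [_ _ _ [s simp_s rs]] := chH i mi.
  exact: simplicial_sheds (sH i) simp_s rs.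
have simp_deletion (i : 'I_n) : hereditarily_simplicial (Hs i) (verts (Hs i) :\ r i).
  have [im|mi] := ltnP i m.
    have [g <- [gP k3]] := cycle_graph_labelling (cycH i im) (rH i).
    exact: cycle_deletion_simplicial gP k3.
  have [_ ch_i _ _] := chH i mi.
  move=> W sW x y xW yW; apply: chordal_simplicial_edge xW yW => //.
  exact: subset_trans sW (subsetDl _ _).
have components : unmixed G' ->
    (forall i : 'I_n, i < m -> #|verts (Hs i)| \in [:: 3; 5]) /\
    (forall i : 'I_n, m <= i -> unmixed (Hs i)).
  move=> um; split=> i => [im|mi].
    have riG : r i \in verts G by rewrite vG imset_f.
    (* A neighbor of r i in G is another root r j; it will force r i out of a suitable facet. *)
    have [y ry] := isoG _ riG.
    have [_] := vG_adj _ _ ry; rewrite vG => /imsetP [j _ Ey].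
    rewrite Ey in ry; exact: (attach_unmixed_cycle sG inj_r vG sH rH disH disG um ry (cycH i im)).
  have [_ _ _ [s simp_s rs]] := chH i mi.
  exact: (attach_unmixed_simplicial sG inj_r vG sH rH disH disG um simp_s rs).
have um_attach : (forall i : 'I_n, i < m -> #|verts (Hs i)| \in [:: 3; 5]) /\
    (forall i : 'I_n, m <= i -> unmixed (Hs i)) -> unmixed G'.
  case=> c35 umH; apply: (attach_unmixed sG inj_r vG sH rH disH disG) => i.
    exact/sheds_root/c35.
  have [im|mi] := ltnP i m; last exact: umH.
  have [g _ [gP k3]] := cycle_graph_labelling (cycH i im) (rH i).
  exact: cycle_unmixed (sH i) gP (c35 i im).
have vd : unmixed G' -> vertex_decomposable G'.
  move=> /components [c35 _].
  apply: (attach_vertex_decomposable sG inj_r vG sH rH disH disG) => // i.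
  exact/sheds_root/c35.
have sh um : shellable G' := vertex_decomposable_shellable sG' (vd um).
split; split=> [um|].
- exact: shellable_cohen_macaulay sG' um (sh um).
- exact: cohen_macaulay_unmixed.
- by split=> //; apply: sh.
- by case.
- by split=> //; apply: vd.
- by case.
- exact: components.
- exact: um_attach.
Qed.
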